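(* For any rational number $\theta=\frac pq$ written in lowest terms ($p\in\mathbb{Z}$, $q\in\mathbb{Z}^+$), let $\mathbb{Z}/q$ act on $C(\mathbb{S}^3_\theta)$ with generator acting by $z_j\mapsto e(1/q)z_j$, $j=1,2$. Then $\dim^{\mathbb{Z}/q}_{\mathrm{SLT}}(C(\mathbb{S}^3_\theta))=\infty$.
   Context: Write $e(x)=\exp(2\pi i x)$. For $\theta\in\mathbb{R}$, $C(\mathbb{S}^3_\theta)$ is the universal unital $C^*$-algebra with generators $z_1,z_2$ and relations $z_jz_j^*=z_j^*z_j$ ($j=1,2$), $z_2z_1=e(\theta)z_1z_2$, $z_1z_1^*+z_2z_2^*=1$. For an action of $\mathbb{Z}/k$ on a unital $C^*$-algebra $A$, the strong local-triviality dimension $\dim^{\mathbb{Z}/k}_{\mathrm{SLT}}(A)$ is the infimum ($\infty$ if there is none) of the $n\in\mathbb{N}=\{0,1,\dots\}$ for which there is a $\mathbb{Z}/k$-equivariant unital $*$-homomorphism $C(E_n(\mathbb{Z}/k))\to A$, where $E_n(\mathbb{Z}/k)$ is the join of $n+1$ copies of $\mathbb{Z}/k$ with the diagonal translation action. Equivalently, it is the infimum of the $n$ for which there exist pairwise commuting normal elements $a_0,\dots,a_n\in A_\gamma$ with spectra in $\{s\,e(m/k): s\in[0,1],\ m\in\{0,1,\dots,k-1\}\}$ and $\sum_{i=0}^n a_ia_i^*=1$, where $\gamma$ is a generator of $\widehat{\mathbb{Z}/k}$ and $A_\gamma=\{a\in A: g\cdot a=\gamma(g)a\ \forall g\in\m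athbb{Z}/k\}$.
   Formalization: The formal statement assumes q ≥ 2: for q = 1 the group Z/1 is trivial, E_0 is a point, and the unital map C → C(S^3_θ) is equivariant, so the dimension is 0 and not ∞. *)

(* Defs.v *)
From HB Require Import structures.
From mathcomp Require Import all_boot all_order all_algebra.
From mathcomp Require Import complex.
From mathcomp Require Import all_classical all_reals all_analysis.
Import Order.TTheory GRing.Theory Num.Theory numFieldNormedType.Exports.

Set Implicit Arguments.
Unset Strict Implicit.
Unset Printing Implicit Defensive.

Local Open Scope classical_set_scope.
Local Open Scope ring_scope.
Local Open Scope quotient_scope.

HB.mixin Record Algebra_hasStar (K : numClosedFieldType) A
    & GRing.Algebra K A := {
  star : A -> A ;
  starK : involutive star ;
  starD : {morph star : a b / a + b} ;
  starM : forall a b, star (a * b) = star b * star a ;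
  starZ : forall (c : K) a, star (c *: a) = c^* *: star a
}.

#[short(type="starAlgType")]
HB.structure Definition StarAlgebra (K : numClosedFieldType) :=
  {A of GRing.Algebra K A & Algebra_hasStar K A}.

(** The norm is not the one of [normedModType]: the hierarchy has no join of
    rings and normed modules that [numDomainType] would inherit from, hence
    rejects a structure inheriting from both. As for every [nzRingType], 1 <> 0. *)
HB.mixin Record StarAlgebra_isCStarAlgebra (R : realType) A
    & StarAlgebra R[i] A := {
  cstar_norm : A -> R ;
  cstar_normD : forall a b, cstar_norm (a + b) <= cstar_norm a + cstar_norm b ;
  cstar_normZ : forall (c : R[i]) a, cstar_norm (c *: a) = ComplexField.Normc.normc c * cstar_norm a ;
  cstar_norm_eq0 : forall a, cstar_norm a = 0 -> a = 0 ;
  cstar_normM : forall a b, cstar_norm (a * b) <= cstar_norm a * cstar_norm b ;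
  cstar_normC : forall a, cstar_norm (star a * a) = cstar_norm a ^+ 2 ;
  cstar_complete : forall u : nat -> A,
    (forall e, 0 < e -> exists N, forall m n, (N <= m)%N -> (N <= n)%N ->
       cstar_norm (u m - u n) < e) ->
    exists l, cstar_norm (u n - l) @[n --> \oo] --> 0
}.

#[short(type="cstarAlgType")]
HB.structure Definition CStarAlgebra (R : realType) :=
  {A of StarAlgebra R[i] A & StarAlgebra_isCStarAlgebra R A}.

(** A unital *-homomorphism is an [{lrmorphism A -> B}] with this property;
    between C*-algebras such maps are automatically contractive. *)
Definition star_preserving (K : numClosedFieldType) (A B : starAlgType K)
  (f : A -> B) : Prop := forall a, f (star a) = star (f a).

Definition contfun (X : ptopologicalType) (K : numClosedFieldType) : Type :=
  continuousType X K^o.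

Section contfun.
Context (X : ptopologicalType) (K : numClosedFieldType).
Local Notation CX := (contfun X K).
Implicit Types f g h : CX.

HB.instance Definition _ := Choice.on CX.

Definition contfun_val f : X -> K := f.
Definition contfun_of (f : X -> K) (cf : continuous (f : X -> K^o)) : CX :=
  @mkcts X K^o f cf.

Lemma contfun_ofE (f : X -> K) (cf : continuous (f : X -> K^o)) x :
  contfun_val (contfun_of cf) x = f x.
Proof. by []. Qed.

Lemma contfunP f g : (forall x, contfun_val f x = contfun_val g x) -> f = g.
Proof. by move=> fg; apply/continuousEP. Qed.

Lemma contfun_cts f : continuous (contfun_val f : X -> K^o).
Proof. exact: cts_fun. Qed.

Fact contfun_cst_cts (c : K) : continuous (fun _ : X => c : K^o).
Proof. by move=> x; exact: cvg_cst. Qed.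
Fact contfun_add_cts f g :
  continuous (fun x => contfun_val f x + contfun_val g x : K^o).
Proof. by move=> x; apply: cvgD; exact: contfun_cts. Qed.
Fact contfun_opp_cts f : continuous (fun x => - contfun_val f x : K^o).
Proof. by move=> x; apply: cvgN; exact: contfun_cts. Qed.
Fact contfun_mul_cts f g :
  continuous (fun x => contfun_val f x * contfun_val g x : K^o).
Proof. by move=> x; apply: (@cvgM K); exact: contfun_cts. Qed.
Fact contfun_scale_cts (c : K) f :
  continuous (fun x => c * contfun_val f x : K^o).
Proof. by move=> x; apply: (@cvgM K); [exact: cvg_cst|exact: contfun_cts]. Qed.
Fact contfun_star_cts f : continuous (fun x => (contfun_val f x)^* : K^o).
Proof.
move=> x; apply/cvgrPdist_lt => e e0.
have /cvgrPdist_lt/(_ e e0) := @contfun_cts f x.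
by apply: filterS => y; rewrite -rmorphB norm_conjC.
Qed.

Definition contfun_cst c : CX := contfun_of (@contfun_cst_cts c).
Definition contfun_add f g : CX := contfun_of (@contfun_add_cts f g).
Definition contfun_opp f : CX := contfun_of (@contfun_opp_cts f).
Definition contfun_mul f g : CX := contfun_of (@contfun_mul_cts f g).
Definition contfun_scale c f : CX := contfun_of (@contfun_scale_cts c f).
Definition contfun_star f : CX := contfun_of (@contfun_star_cts f).

Fact contfun_addA : associative contfun_add.
Proof. by move=> f g h; apply: contfunP => x; exact: addrA. Qed.
Fact contfun_addC : commutative contfun_add.
Proof. by move=> f g; apply: contfunP => x; exact: addrC. Qed.
Fact contfun_add0 : left_id (contfun_cst 0) contfun_add.
Proof. by move=> f; apply: contfunP => x; exact: add0r. Qed.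
Fact contfun_addN : left_inverse (contfun_cst 0) contfun_opp contfun_add.
Proof. by move=> f; apply: contfunP => x; exact: addNr. Qed.
HB.instance Definition _ := GRing.isZmodule.Build CX
  contfun_addA contfun_addC contfun_add0 contfun_addN.

Fact contfun_mulA : associative contfun_mul.
Proof. by move=> f g h; apply: contfunP => x; exact: mulrA. Qed.
Fact contfun_mulC : commutative contfun_mul.
Proof. by move=> f g; apply: contfunP => x; exact: mulrC. Qed.
Fact contfun_mul1 : left_id (contfun_cst 1) contfun_mul.
Proof. by move=> f; apply: contfunP => x; exact: mul1r. Qed.
Fact contfun_mulDl : left_distributive contfun_mul contfun_add.
Proof. by move=> f g h; apply: contfunP => x; exact: mulrDl. Qed.
Fact contfun_1neq0 : contfun_cst 1 != contfun_cst 0.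
Proof.
by apply/eqP => /(congr1 (fun f => contfun_val f point)) /eqP; exact/negP/oner_neq0.
Qed.
HB.instance Definition _ := GRing.Zmodule_isComNzRing.Build CX
  contfun_mulA contfun_mulC contfun_mul1 contfun_mulDl contfun_1neq0.

Fact contfun_scaleA (a b : K) f :
  contfun_scale a (contfun_scale b f) = contfun_scale (a * b) f.
Proof. by apply: contfunP => x; exact: mulrA. Qed.
Fact contfun_scale1 : left_id 1 contfun_scale.
Proof. by move=> f; apply: contfunP => x; exact: mul1r. Qed.
Fact contfun_scaleDr : right_distributive contfun_scale +%R.
Proof. by move=> c f g; apply: contfunP => x; exact: mulrDr. Qed.
Fact contfun_scaleDl f : {morph contfun_scale^~ f : a b / a + b}.
Proof. by move=> a b; apply: contfunP => x; exact: mulrDl. Qed.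
HB.instance Definition _ := GRing.Zmodule_isLmodule.Build K CX
  contfun_scaleA contfun_scale1 contfun_scaleDr contfun_scaleDl.

Fact contfun_scaleAl (c : K) f g : c *: (f * g) = (c *: f) * g.
Proof. by apply: contfunP => x; exact: mulrA. Qed.
HB.instance Definition _ := GRing.Lmodule_isLalgebra.Build K CX contfun_scaleAl.
HB.instance Definition _ := GRing.Lalgebra_isComAlgebra.Build K CX.

Fact contfun_starK : involutive contfun_star.
Proof. by move=> f; apply: contfunP => x; exact: conjCK. Qed.
Fact contfun_starD : {morph contfun_star : f g / f + g}.
Proof. by move=> f g; apply: contfunP => x; exact: rmorphD. Qed.
Fact contfun_starM f g : contfun_star (f * g) = contfun_star g * contfun_star f.
Proof. by apply: contfunP => x; rewrite [RHS]mulrC; exact: rmorphM. Qed.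
Fact contfun_starZ (c : K) f : contfun_star (c *: f) = c^* *: contfun_star f.
Proof. by apply: contfunP => x; exact: rmorphM. Qed.
HB.instance Definition _ := Algebra_hasStar.Build K CX
  contfun_starK contfun_starD contfun_starM contfun_starZ.

End contfun.

Definition contfun_precomp (X : ptopologicalType) (K : numClosedFieldType)
    (u : continuousType X X) (f : contfun X K) : contfun X K :=
  (f : continuousType X K^o) \o u.

Section join.
Context (R : realType) (G : finZmodType) (n : nat).

Definition simplex : set 'rV[R]_n.+1 :=
  [set t | (forall i, 0 <= t 0 i) /\ \sum_i t 0 i = 1].

Fact simplex_vertex : simplex (\row_i (i == 0)%:R).
Proof.
split=> [i|]; first by rewrite mxE ler0n.
rewrite (bigD1 0)//= mxE eqxx big1 ?addr0// => i /negPf i0.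
by rewrite mxE i0.
Qed.

(** The point with barycentric coordinates [t] and group coordinates [g] is the
    formal combination t_0 g_0 + ... + t_n g_n; in the join, [g_i] is forgotten
    when [t_i = 0]. *)
Definition join_pre : Type :=
  (set_type simplex * discrete_topology {ffun 'I_n.+1 -> G})%type.
HB.instance Definition _ := Topological.on join_pre.
HB.instance Definition _ := isPointed.Build join_pre
  (SigSub (mem_set simplex_vertex) : set_type simplex, [ffun=> 0]).

Definition join_bary (x : join_pre) : 'rV[R]_n.+1 := set_val x.1.
Definition join_grp (x : join_pre) : {ffun 'I_n.+1 -> G} := x.2.

Definition join_rel (x y : join_pre) : bool :=
  (join_bary x == join_bary y) &&
  [forall i, (join_bary x 0 i != 0) ==> (join_grp x i == join_grp y i)].

Fact join_rel_refl : reflexive join_rel.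
Proof.
by move=> x; rewrite /join_rel eqxx; apply/forallP => i; rewrite eqxx implybT.
Qed.

Fact join_rel_sym : symmetric join_rel.
Proof.
move=> x y; rewrite /join_rel eq_sym; case: eqP => //= ->.
by apply: eq_forallb => i; rewrite [join_grp x i == _]eq_sym.
Qed.

Fact join_rel_trans : transitive join_rel.
Proof.
move=> y x z /andP[/eqP xy /forallP gxy] /andP[/eqP yz /forallP gyz].
rewrite /join_rel xy yz eqxx; apply/forallP => i; apply/implyP => ti.
have /implyP/(_ _)/eqP <- := gyz i; last by rewrite yz.
by have /implyP/(_ _) := gxy i; apply; rewrite xy yz.
Qed.

Canonical join_equiv := EquivRel join_rel join_rel_refl join_rel_sym
  join_rel_trans.

Definition join : Type := quotient_topology {eq_quot join_equiv}.
HB.instance Definition _ := Topological.on join.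
HB.instance Definition _ := Quotient.on join.
HB.instance Definition _ := Pointed.on join.

Definition join_pre_translate (g : G) (x : join_pre) : join_pre :=
  (x.1, [ffun i => join_grp x i + g]).

Fact join_pre_translate_continuous g : continuous (join_pre_translate g).
Proof.
move=> [t h] U [[V W] /= [nV nW] VWU].
exists (V, [set h]); first by split=> //; exact: discrete_set1.
move=> [t' h'] /= [Vt' ->]; apply: VWU; split=> //=.
by move: nW; rewrite nbhs_principalE => /principal_filterP.
Qed.

Fact join_pre_translate_rel g x y : join_rel x y ->
  join_rel (join_pre_translate g x) (join_pre_translate g y).
Proof.
move=> /andP[xy /forallP gxy]; apply/andP; split=> //.
apply/forallP => i; apply/implyP => ti; rewrite !ffunE.
by have /implyP/(_ ti)/eqP -> := gxy i.
Qed.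

Definition join_translate (g : G) (x : join) : join :=
  \pi_join (join_pre_translate g (repr x)).

Lemma join_translate_pi g (x : join_pre) :
  join_translate g (\pi_join x) = \pi_join (join_pre_translate g x).
Proof.
apply/eqmodP/join_pre_translate_rel.
have : \pi_join (repr (\pi_join x)) = \pi_join x by rewrite reprK.
by move/eqmodP.
Qed.

Fact join_translate_continuous g : continuous (join_translate g).
Proof.
apply/quotient_continuous => x.
rewrite (_ : _ \o _ = \pi_join \o join_pre_translate g); last first.
  by apply/funext => y /=; rewrite join_translate_pi.
apply: continuous_comp; first exact: join_pre_translate_continuous.
exact: pi_continuous.
Qed.
HB.instance Definition _ g :=
  isContinuous.Build join join (join_translate g) (@join_translate_continuous g).

End join.

Definition star_action (K : numClosedFieldType) (G : finZmodType)
    (A : starAlgType K) (act : G -> {lrmorphism A -> A}) : Prop :=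
  [/\ forall g, star_preserving (act g),
      forall a, act 0 a = a &
      forall g h a, act (g + h) a = act g (act h a)].

(** Since [G] is abelian, [g |-> (f |-> f (_ + g))] is an action on functions;
    using [f (_ - g)] instead gives the same condition, the inversion of [G]
    inducing a homeomorphism of the join. *)
Definition SLT_le (R : realType) (G : finZmodType) (A : cstarAlgType R)
    (act : G -> {lrmorphism A -> A}) (n : nat) : Prop :=
  exists phi : {lrmorphism contfun (join R G n) R[i] -> A},
    star_preserving phi /\
    forall g f, phi (contfun_precomp (join_translate g) f) = act g (phi f).

Definition SLT_dim (R : realType) (G : finZmodType) (A : cstarAlgType R)
    (act : G -> {lrmorphism A -> A}) : \bar R :=
  ereal_inf [set (n%:R : R)%:E | n in SLT_le act].

Definition expi2pi (R : realType) (x : R) : R[i] :=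
  Complex (cos (2 * pi * x)) (sin (2 * pi * x)).

Definition sphere3_rel (R : realType) (theta : R) (A : starAlgType R[i])
    (z1 z2 : A) : Prop :=
  [/\ z1 * star z1 = star z1 * z1,
      z2 * star z2 = star z2 * z2,
      z2 * z1 = expi2pi theta *: (z1 * z2) &
      z1 * star z1 + z2 * star z2 = 1].

(** The universal property determines ([A], [z1], [z2]) up to a unique
    isomorphism, so it is used as the definition of C(S^3_theta). *)
Definition is_sphere3 (R : realType) (theta : R) (A : cstarAlgType R)
    (z1 z2 : A) : Prop :=
  sphere3_rel theta z1 z2 /\
  forall (B : cstarAlgType R) (w1 w2 : B), sphere3_rel theta w1 w2 ->
    (exists f : {lrmorphism A -> B},
        [/\ star_preserving f, f z1 = w1 & f z2 = w2]) /\
    (forall f f' : {lrmorphism A -> B},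
        [/\ star_preserving f, f z1 = w1 & f z2 = w2] ->
        [/\ star_preserving f', f' z1 = w1 & f' z2 = w2] -> f =1 f').

(* Main.v *)
From HB Require Import structures.
Require Import Defs.
From mathcomp Require Import all_boot all_order all_algebra.
From mathcomp Require Import complex.
From mathcomp Require Import all_classical all_reals all_analysis.
From mathcomp Require Import ring lra.
Import Order.TTheory GRing.Theory Num.Theory numFieldNormedType.Exports.
Import ComplexField.Normc.
Set Implicit Arguments.
Unset Strict Implicit.
Unset Printing Implicit Defensive.
Local Open Scope classical_set_scope.
Local Open Scope ring_scope.

(** Suppose that the dimension is at most [n]. The coordinate functions
    [sqrt t_i * e (g_i / q)] of the join are mapped to commuting elements [a_i]
    of the algebra A of the sphere that satisfy [sum_i a_i a_i^* = 1] and are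
    multiplied by [w = e (1 / q)] under the generator of the group. Such a family
    cannot exist, for a reason of homotopy.

    Put [zeta = e theta]. In the matrix algebra M_q let U be the cyclic shift of
    the basis, V the shift with weights [zeta ^ k], so that [V U = zeta U V], and
    W the diagonal matrix of the [w ^ k]. For [(s, x)] in the unit square,
    [z_1 = sin (pi s / 2) e (theta x) U] and [z_2 = cos (pi s / 2) V] define a
    representation of A; together they are one map from A to the C*-algebra of
    continuous functions from the square to M_q, given by the universal property,
    so that the image of every element depends continuously on [(s, x)]. By
    uniqueness in the universal property, the action becomes the conjugation by
    W in each of these representations. Hence each [a_i] becomes a weighted
    cyclic shift, and the relations satisfied by the [a_i] say that the vectors
    of weights at two consecutive edges of the cycle [0 -> 1 -> ... -> 0] are unit
    vectors which differ by a scalar [rho_k] of modulus 1 ([ratio]). These q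
    continuous functions [rho_k] on the square have product 1 ([ratio_prod]).

    Uniqueness also gives their boundary values. At [s = 0] everything commutes
    with V, which forces [rho_k = zeta], and at [s = 1] everything commutes with U,
    which forces [rho_k = 1] ([ratio_comm]). As [V U V^* = zeta U], the
    representations at [(s, 0)] and [(s, 1)] are conjugate by V, which gives
    [rho_(k+1) (s, 1) = rho_k (s, 0)] ([ratio_conj]). So [x] parametrises a
    homotopy with fixed ends from the path [rho_k (-, 0)] to the path
    [rho_(k-1) (-, 0)]. All q paths are thus homotopic, with product 1, and the
    net variation of the argument along each of them vanishes; since they run
    from [zeta] to 1, this gives [zeta = 1] ([no_homotopy]), while
    [theta = p / q] is not an integer.

    The matrix-valued functions on a compact space are shown to form a C*-algebra
    with the operator norm, and the homotopy argument is carried out with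
    explicit q-th roots of functions close to 1 instead of covering spaces. *)

(** * Continuity of complex functions *)

Section ComplexContinuity.
Context (R : realType).
Local Notation C := R[i].

Lemma normc_ge0 (z : C) : 0 <= normc z.
Proof. by case: z => a b; exact: sqrtr_ge0. Qed.

Lemma normcE (z : C) : `|z| = (normc z)%:C%C.
Proof. by []. Qed.

Lemma normc_conj (z : C) : normc z^* = normc z.
Proof. by case: z => a b; rewrite /= sqrrN. Qed.

Lemma mul_conjc (z : C) : z^* * z = (normc z ^+ 2)%:C%C.
Proof. by rewrite mulrC -normCK normcE rmorphXn. Qed.

Lemma normcX (z : C) n : normc (z ^+ n) = normc z ^+ n.
Proof. by elim: n => [|n IH]; [exact: (normc1 R)|rewrite !exprS normcM IH]. Qed.

Lemma normc_sum (I : Type) (r : seq I) (P : pred I) (F : I -> C) :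
  normc (\sum_(i <- r | P i) F i) <= \sum_(i <- r | P i) normc (F i).
Proof.
elim/big_ind2: _ => [|x1 x2 y1 y2 h1 h2|//]; first by rewrite normc0.
exact: le_trans (le_normcD _ _) (lerD h1 h2).
Qed.

Lemma Re_le_normc (z : C) : `|complex.Re z| <= normc z.
Proof.
case: z => a b /=; rewrite -sqrtr_sqr ler_sqrt ?addr_ge0 ?sqr_ge0//.
by rewrite lerDl sqr_ge0.
Qed.

Lemma Im_le_normc (z : C) : `|complex.Im z| <= normc z.
Proof.
case: z => a b /=; rewrite -sqrtr_sqr ler_sqrt ?addr_ge0 ?sqr_ge0//.
by rewrite lerDr sqr_ge0.
Qed.

Lemma normc_le_ReIm (z : C) : normc z <= `|complex.Re z| + `|complex.Im z|.
Proof.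
case: z => a b /=; rewrite -[leRHS]ger0_norm ?addr_ge0// -sqrtr_sqr.
rewrite ler_sqrt ?sqr_ge0// sqrrD !real_normK ?num_real// lerD2r lerDl.
by rewrite mulrn_wge0// mulr_ge0.
Qed.

(** Convergence in the normed space [C] is stated with tolerances in [C]; the
    estimates below are all real. *)
Lemma cvgcP (T : Type) (F : set_system T) {FF : Filter F} (f : T -> C) (l : C) :
  (f @ F --> (l : C^o)) <->
  forall e : R, 0 < e -> \forall y \near F, normc (l - f y) < e.
Proof.
split=> [/(@cvgrPdist_lt C C^o) cf e e0|cf].
  have /cf : 0 < e%:C%C by rewrite ltcR.
  by apply: filterS => y; rewrite normcE ltcR.
apply/(@cvgrPdist_lt C C^o) => -[a b]; rewrite ltcE/= => /andP[/eqP b0 a0].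
by apply: filterS (cf a a0) => y h; rewrite normcE ltcE/= b0 eqxx.
Qed.

Lemma cvgcRI (T : Type) (F : set_system T) {FF : Filter F} (f g : T -> R) a b :
  f @ F --> a -> g @ F --> b ->
  (fun x => Complex (f x) (g x)) @ F --> (Complex a b : C^o).
Proof.
move=> /cvgrPdist_lt cf /cvgrPdist_lt cg; apply/cvgcP => e e0.
have e2 : 0 < e / 2 by rewrite divr_gt0.
near=> y; apply: le_lt_trans (normc_le_ReIm _) _.
rewrite [ltRHS]splitr ltrD//=.
  by near: y; exact: cf.
by near: y; exact: cg.
Unshelve. all: by end_near. Qed.

Lemma cvg_Im (T : Type) (F : set_system T) {FF : Filter F} (f : T -> C) (l : C) :
  f @ F --> (l : C^o) -> complex.Im (f x) @[x --> F] --> complex.Im l.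
Proof.
move=> /cvgcP cf; apply/cvgrPdist_lt => e /cf; apply: filterS => y.
by apply: le_lt_trans; rewrite -raddfB; exact: Im_le_normc.
Qed.

Lemma cvg_normc (T : Type) (F : set_system T) {FF : Filter F} (f : T -> C) (l : C) :
  f @ F --> (l : C^o) -> normc (f x) @[x --> F] --> normc l.
Proof.
move=> /cvgcP cf; apply/cvgrPdist_lt => e /cf; apply: filterS => y.
apply: le_lt_trans; rewrite ler_norml.
have := le_normcD (l - f y) (f y); have := le_normcD (f y - l) l.
rewrite -(normcN (f y - l)) opprB !subrK => h1 h2; lra.
Qed.

(** Completeness of the algebra of continuous functions for uniform
    convergence; the completeness of matrix algebras is reduced to it entry by
    entry. *)
Lemma contfun_cauchy (X : ptopologicalType) (u : nat -> contfun X C) :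
  (forall e : R, 0 < e -> exists N, forall m n, (N <= m)%N -> (N <= n)%N ->
     forall x, normc (contfun_val (u m) x - contfun_val (u n) x) < e) ->
  exists l : contfun X C, forall e : R, 0 < e ->
    exists N, forall n, (N <= n)%N ->
    forall x, normc (contfun_val (u n) x - contfun_val l x) <= e.
Proof.
move=> uc.
have cvgR (r : nat -> X -> R) :
    (forall m n x, `|r m x - r n x| <=
       normc (contfun_val (u m) x - contfun_val (u n) x)) ->
    forall x, cvg (r n x @[n --> \oo]).
  move=> ru x; apply/cauchy_cvgP/cauchy_exP => e e0.
  have [N hN] := uc _ e0; exists (r N x).
  exists N => // n /= Nn; rewrite -ball_normE/=; apply: (le_lt_trans (ru N n x)).
  exact: hN.
pose a n x := complex.Re (contfun_val (u n) x).
pose b n x := complex.Im (contfun_val (u n) x).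
have ca x : cvg (a n x @[n --> \oo]).
  by apply: (cvgR a) => m n y; rewrite -raddfB; exact: Re_le_normc.
have cb x : cvg (b n x @[n --> \oo]).
  by apply: (cvgR b) => m n y; rewrite -raddfB; exact: Im_le_normc.
pose l x : C := Complex (lim (a n x @[n --> \oo])) (lim (b n x @[n --> \oo])).
have ul x : contfun_val (u n) x @[n --> \oo] --> (l x : C^o).
  rewrite (_ : (fun n => _) = fun n => Complex (a n x) (b n x)).
    exact: (cvgcRI (ca x) (cb x)).
  by apply/funext => n; rewrite /a /b; case: (contfun_val _ _).
have unif e : 0 < e -> exists N, forall n, (N <= n)%N ->
    forall x, normc (contfun_val (u n) x - l x) <= e.
  move=> e0; have [N hN] := uc e e0; exists N => n Nn x.
  have h : (fun k => normc (contfun_val (u n) x - contfun_val (u k) x)) @ \oo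
      --> normc (contfun_val (u n) x - l x).
    by apply: cvg_normc; apply: (@cvgB C C^o); [exact: cvg_cst|exact: ul].
  rewrite -(cvg_lim _ h)//.
  apply: limr_le; first exact: cvgP h.
  by near=> k; apply/ltW/hN => //; near: k; exists N.
have lc : continuous (l : X -> C^o).
  move=> x; apply/cvgcP => e e0; have e3 : 0 < e / 3 by rewrite divr_gt0.
  have [N hN] := unif _ e3.
  have /cvgcP/(_ _ e3) := @contfun_cts _ _ (u N) x.
  apply: filterS => y h.
  have h1 := hN N (leqnn _) x; have h2 := hN N (leqnn _) y.
  set p := contfun_val (u N) x in h h1 *; set q := contfun_val (u N) y in h h2 *.
  have -> : l x - l y = - (p - l x) + ((p - q) + (q - l y)) by ring.
  apply: le_lt_trans (le_normcD _ _) _; rewrite normcN.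
  have := le_normcD (p - q) (q - l y); lra.
exists (contfun_of lc) => e /unif[N hN]; exists N => n Nn x.
by rewrite contfun_ofE; exact: hN.
Unshelve. all: by end_near. Qed.

End ComplexContinuity.

(** * Hermitian inner product and matrices *)

Section Hermitian.
Context (R : realType) (n : nat).
Local Notation C := R[i].
Implicit Types (u v w : 'I_n -> C) (M N : 'M[C]_n).

Definition dot u v : C := \sum_i (u i)^* * v i.
Definition mxapp M v : 'I_n -> C := fun i => \sum_j M i j * v j.
Definition l2norm v : R := Num.sqrt (\sum_i normc (v i) ^+ 2).
Definition adj M : 'M[C]_n := \matrix_(i, j) (M j i)^*.

Lemma nrm_ge0 v : 0 <= l2norm v. Proof. exact: sqrtr_ge0. Qed.

Lemma sqr_nrm v : l2norm v ^+ 2 = \sum_i normc (v i) ^+ 2.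
Proof. by rewrite sqr_sqrtr// sumr_ge0// => i _; rewrite sqr_ge0. Qed.

Lemma dotvv v : dot v v = (l2norm v ^+ 2)%:C%C.
Proof. by rewrite sqr_nrm rmorph_sum; apply: eq_bigr => i _; exact: mul_conjc. Qed.

Lemma normc_dotvv v : normc (dot v v) = l2norm v ^+ 2.
Proof. by rewrite dotvv/= expr0n addr0 sqrtr_sqr ger0_norm// sqr_ge0. Qed.

(** The sum of the squares of [B * a i - D * b i], with [D] the inner product
    and [B] the squared norm of [b], equals [B * (A * B - D ^+ 2)]. *)
Lemma CauchySchwarz_sum (a b : 'I_n -> R) :
  (\sum_i a i * b i) ^+ 2 <= (\sum_i a i ^+ 2) * (\sum_i b i ^+ 2).
Proof.
set D := \sum_i a i * b i; set A := \sum_i a i ^+ 2; set B := \sum_i b i ^+ 2.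
have B0 : 0 <= B by apply: sumr_ge0 => i _; exact: sqr_ge0.
have h : 0 <= \sum_i (B * a i - D * b i) ^+ 2.
  by apply: sumr_ge0 => i _; exact: sqr_ge0.
have E : \sum_i (B * a i - D * b i) ^+ 2 = B * (A * B - D ^+ 2).
  transitivity (\sum_i (B ^+ 2 * a i ^+ 2 - 2 * B * D * (a i * b i)
      + D ^+ 2 * b i ^+ 2)).
    by apply: eq_bigr => i _; move: B D {B0 h} => B D; ring.
  rewrite big_split/= sumrB -!mulr_sumr -/A -/B -/D.
  by move: A B D {B0 h} => A B D; ring.
have [B_eq0|Bneq0] := eqVneq B 0; last first.
  by rewrite E pmulr_rge0 ?subr_ge0// lt_def Bneq0 in h.
have b0 i : b i = 0.
  apply/eqP; rewrite -sqrf_eq0; apply/eqP.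
  by apply: (psumr_eq0P _ B_eq0) => // j _; exact: sqr_ge0.
by rewrite /D big1 ?expr0n ?B_eq0 ?mulr0// => i _; rewrite b0 mulr0.
Qed.

Lemma dot_le u v : normc (dot u v) <= l2norm u * l2norm v.
Proof.
apply: (@le_trans _ _ (\sum_i normc (u i) * normc (v i))).
  apply: le_trans (normc_sum _ _ _) _.
  by apply: ler_sum => i _; rewrite normcM normc_conj.
rewrite -(@ler_pXn2r _ 2)// ?nnegrE ?mulr_ge0 ?nrm_ge0//; last first.
  by apply: sumr_ge0 => i _; rewrite mulr_ge0 ?normc_ge0.
by rewrite exprMn !sqr_nrm; exact: CauchySchwarz_sum.
Qed.

Lemma dotZ (a b : C) u v :
  dot (fun i => a * u i) (fun i => b * v i) = a^* * b * dot u v.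
Proof. by rewrite /dot mulr_sumr; apply: eq_bigr => i _; rewrite rmorphM/=; ring. Qed.

Lemma appZ (a : C) M v : mxapp M (fun i => a * v i) = fun i => a * mxapp M v i.
Proof.
by apply/funext => i; rewrite /mxapp mulr_sumr; apply: eq_bigr => j _; ring.
Qed.

Lemma appM M N v : mxapp (M *m N) v = mxapp M (mxapp N v).
Proof.
apply/funext => i; rewrite /mxapp.
under eq_bigr do rewrite mxE mulr_suml.
rewrite exchange_big; apply: eq_bigr => j _.
by rewrite mulr_sumr; apply: eq_bigr => k _; rewrite mulrA.
Qed.

Lemma dot_adj M u v : dot u (mxapp (adj M) v) = dot (mxapp M u) v.
Proof.
rewrite /dot /mxapp.
under eq_bigr do rewrite mulr_sumr.
rewrite exchange_big; apply: eq_bigr => j _.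
rewrite rmorph_sum mulr_suml; apply: eq_bigr => k _.
by rewrite mxE rmorphM/=; ring.
Qed.

Lemma dotC u v : dot v u = (dot u v)^*.
Proof.
by rewrite /dot rmorph_sum; apply: eq_bigr => i _; rewrite rmorphM/= conjCK mulrC.
Qed.

Lemma nrmZ (a : R) v : l2norm (fun i => a%:C%C * v i) = `|a| * l2norm v.
Proof.
rewrite /l2norm -sqrtr_sqr -sqrtrM ?sqr_ge0// mulr_sumr; congr Num.sqrt.
by apply: eq_bigr => i _; rewrite normcM/= expr0n addr0 exprMn sqr_sqrtr ?sqr_ge0.
Qed.

Lemma nrm_eq0 v : l2norm v = 0 -> v = fun=> 0.
Proof.
move=> v0; have : l2norm v ^+ 2 = 0 by rewrite v0 expr0n.
rewrite sqr_nrm => h; apply/funext => i; apply: eq0_normc; apply/eqP.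
rewrite -sqrf_eq0; apply/eqP.
by apply: (psumr_eq0P _ h) => // j _; exact: sqr_ge0.
Qed.

Lemma nrm_delta k : l2norm (fun i => (i == k)%:R) = 1.
Proof.
rewrite /l2norm (bigD1 k)//= eqxx big1 ?addr0 => [|i /negPf ->].
  by rewrite (normc1 R) expr1n sqrtr1.
by rewrite (normc0 R) expr0n.
Qed.

Lemma dot_delta M j k :
  dot (fun i => (i == j)%:R) (mxapp M (fun i => (i == k)%:R)) = M j k.
Proof.
rewrite /dot (bigD1 j)//= big1 ?addr0 => [|i /negPf ->]; last first.
  by rewrite rmorph0 mul0r.
rewrite eqxx rmorph1 mul1r /mxapp (bigD1 k)//= big1 ?addr0 => [|i /negPf ->].
  by rewrite eqxx mulr1.
by rewrite mulr0.
Qed.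

Lemma normc_le_nrm v i : normc (v i) <= l2norm v.
Proof.
rewrite -(@ler_pXn2r _ 2)// ?nnegrE ?normc_ge0 ?nrm_ge0// sqr_nrm (bigD1 i)//=.
by rewrite lerDl sumr_ge0// => j _; exact: sqr_ge0.
Qed.

(** A crude bound, but it is enough to see that operator norms are finite and
    that uniform convergence of the entries implies convergence in norm. *)
Lemma form_le_entries M u v (e : R) : l2norm u <= 1 -> l2norm v <= 1 ->
  (forall i j, normc (M i j) <= e) ->
  normc (dot u (mxapp M v)) <= e *+ n *+ n.
Proof.
move=> u1 v1 Me; apply: le_trans (normc_sum _ _ _) _.
apply: le_trans (_ : \sum_(i < n) e *+ n <= _); last by rewrite sumr_const card_ord.
apply: ler_sum => i _; rewrite normcM normc_conj.
apply: le_trans (_ : normc (mxapp M v i) <= _).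
  rewrite ler_piMl ?normc_ge0//; exact: le_trans (normc_le_nrm _ _) u1.
apply: le_trans (normc_sum _ _ _) _.
apply: le_trans (_ : \sum_(j < n) e <= _); last by rewrite sumr_const card_ord.
apply: ler_sum => j _; rewrite normcM.
apply: le_trans (_ : normc (M i j) <= _); last exact: Me.
by rewrite ler_piMr ?normc_ge0//; exact: le_trans (normc_le_nrm _ _) v1.
Qed.

End Hermitian.

(** * The C*-algebra of matrix-valued functions *)

(** The algebra C(X, M_(m+1)), as matrices over the commutative ring C(X), which
    provides the ring structure. Compactness of [X], needed for norms to be
    finite, is a parameter of the type so that structures can be attached to
    it. *)
Definition mxfun (X : ptopologicalType) (hX : compact [set: X]) (R : realType)
  (m : nat) : Type := 'M[contfun X R[i]]_m.+1.

Section MatrixFunctions.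
Context (X : ptopologicalType) (hX : compact [set: X]) (R : realType) (m : nat).
Local Notation C := R[i].
Local Notation B := (mxfun hX R m).
Implicit Types (f g : B) (y : X) (M : 'M[C]_m.+1).

HB.instance Definition _ := GRing.NzRing.on B.

Definition ev f y : 'M[C]_m.+1 := \matrix_(i, j) contfun_val (f i j) y.

Lemma evP f g : (forall y, ev f y = ev g y) -> f = g.
Proof.
move=> fg; apply/matrixP => i j; apply: contfunP => y.
by have /matrixP/(_ i j) := fg y; rewrite !mxE.
Qed.

Lemma evD f g y : ev (f + g) y = ev f y + ev g y.
Proof. by apply/matrixP => i j; rewrite !mxE. Qed.

Lemma contfun_val_sum (I : Type) (r : seq I) (P : pred I)
    (F : I -> contfun X C) y :
  contfun_val (\sum_(i <- r | P i) F i) y = \sum_(i <- r | P i) contfun_val (F i) y.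
Proof. by elim/big_rec2: _ => [//|i a b _ <-]. Qed.

Lemma evM f g y : ev (f * g) y = ev f y * ev g y.
Proof.
apply/matrixP => i j; rewrite !mxE contfun_val_sum.
by apply: eq_bigr => k _; rewrite !mxE.
Qed.

Lemma ev1 y : ev 1 y = 1.
Proof. by apply/matrixP => i j; rewrite !mxE; case: eqP. Qed.

Lemma ev0 y : ev 0 y = 0.
Proof. by apply/matrixP => i j; rewrite !mxE. Qed.

Lemma ev_sum (I : Type) (r : seq I) (P : pred I) (F : I -> B) y :
  ev (\sum_(i <- r | P i) F i) y = \sum_(i <- r | P i) ev (F i) y.
Proof. by elim/big_rec2: _ => [|i a b _ <-]; rewrite ?ev0 ?evD. Qed.

Definition mxfun_scale (c : C) f : B := map_mx (contfun_scale c) f.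

Lemma ev_mxfun_scale c f y : ev (mxfun_scale c f) y = c *: ev f y.
Proof. by apply/matrixP => i j; rewrite !mxE. Qed.

Fact mxfun_scaleA a b f : mxfun_scale a (mxfun_scale b f) = mxfun_scale (a * b) f.
Proof. by apply: evP => y; rewrite !ev_mxfun_scale scalerA. Qed.
Fact mxfun_scale1 : left_id 1 mxfun_scale.
Proof. by move=> f; apply: evP => y; rewrite !ev_mxfun_scale scale1r. Qed.
Fact mxfun_scaleDr : right_distributive mxfun_scale +%R.
Proof. by move=> c f g; apply: evP => y; rewrite !(ev_mxfun_scale, evD) scalerDr. Qed.
Fact mxfun_scaleDl f : {morph mxfun_scale^~ f : a b / a + b}.
Proof. by move=> a b; apply: evP => y; rewrite !(ev_mxfun_scale, evD) scalerDl. Qed.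
HB.instance Definition _ := GRing.Zmodule_isLmodule.Build C B
  mxfun_scaleA mxfun_scale1 mxfun_scaleDr mxfun_scaleDl.

Lemma evZ c f y : ev (c *: f) y = c *: ev f y.
Proof. exact: ev_mxfun_scale. Qed.

Fact mxfun_scaleAl c f g : c *: (f * g) = (c *: f) * g.
Proof. by apply: evP => y; rewrite !(evZ, evM) scalerAl. Qed.
Fact mxfun_scaleAr c f g : c *: (f * g) = f * (c *: g).
Proof. by apply: evP => y; rewrite !(evZ, evM) scalerAr. Qed.
HB.instance Definition _ := GRing.Lmodule_isLalgebra.Build C B mxfun_scaleAl.
HB.instance Definition _ := GRing.Lalgebra_isAlgebra.Build C B mxfun_scaleAr.

Definition mxfun_star f : B := \matrix_(i, j) contfun_star (f j i).

Lemma ev_mxfun_star f y : ev (mxfun_star f) y = adj (ev f y).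
Proof. by apply/matrixP => i j; rewrite !mxE. Qed.

Lemma adjK M : adj (adj M) = M.
Proof. by apply/matrixP => i j; rewrite !mxE conjCK. Qed.
Lemma adjD M N : adj (M + N) = adj M + adj N.
Proof. by apply/matrixP => i j; rewrite !mxE rmorphD. Qed.
Lemma adjM M N : adj (M * N) = adj N * adj M.
Proof.
apply/matrixP => i j; rewrite !mxE rmorph_sum; apply: eq_bigr => k _.
by rewrite !mxE rmorphM mulrC.
Qed.
Lemma adjZ c M : adj (c *: M) = c^* *: adj M.
Proof. by apply/matrixP => i j; rewrite !mxE rmorphM. Qed.

Fact mxfun_starK : involutive mxfun_star.
Proof. by move=> f; apply: evP => y; rewrite !ev_mxfun_star adjK. Qed.
Fact mxfun_starD : {morph mxfun_star : f g / f + g}.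
Proof. by move=> f g; apply: evP => y; rewrite !(ev_mxfun_star, evD) adjD. Qed.
Fact mxfun_starM f g : mxfun_star (f * g) = mxfun_star g * mxfun_star f.
Proof. by apply: evP => y; rewrite !(ev_mxfun_star, evM) adjM. Qed.
Fact mxfun_starZ c f : mxfun_star (c *: f) = c^* *: mxfun_star f.
Proof. by apply: evP => y; rewrite !(ev_mxfun_star, evZ) adjZ. Qed.
HB.instance Definition _ :=
  Algebra_hasStar.Build C B mxfun_starK mxfun_starD mxfun_starM mxfun_starZ.

Lemma ev_star f y : ev (star f) y = adj (ev f y).
Proof. exact: ev_mxfun_star. Qed.

(** The operator norm is taken as the supremum of the moduli of the sesquilinear
    forms over all points and all pairs of vectors of the unit ball: with this
    choice the triangle inequality and the invariance under the adjoint are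
    immediate, and Cauchy-Schwarz is used only for the C*-identity. *)
Definition opnorm_values f : set R := [set r | exists y (u v : 'I_m.+1 -> C),
  [/\ l2norm u <= 1, l2norm v <= 1 & r = normc (dot u (mxapp (ev f y) v))]].

Definition opnorm f : R := sup (opnorm_values f).

Lemma contfun_bounded (h : contfun X C) :
  exists e : R, forall y, normc (contfun_val h y) <= e.
Proof.
have cont : {within [set: X], continuous (fun y => normc (contfun_val h y))}.
  by apply: continuous_subspaceT => y; apply: cvg_normc; exact: contfun_cts.
have /compact_bounded[e [_ he]] := continuous_compact cont hX.
exists (e + 1) => y; apply: le_trans (ler_norm _) _.
by apply: (he (e + 1)); [rewrite ltrDl|exists y].
Qed.

Lemma entries_bounded f : exists e : R, forall y i j, normc (ev f y i j) <= e.
Proof.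
have [e he] := choice (fun ij : 'I_m.+1 * 'I_m.+1 => contfun_bounded (f ij.1 ij.2)).
exists (\sum_ij `|e ij|) => y i j; rewrite mxE.
apply: le_trans (he (i, j) y) _; apply: le_trans (ler_norm _) _.
by rewrite (bigD1 (i, j))//= lerDl sumr_ge0.
Qed.

Lemma has_ubound_opnorm f : has_ubound (opnorm_values f).
Proof.
have [e he] := entries_bounded f.
exists (e *+ m.+1 *+ m.+1) => _ [y [u [v [u1 v1 ->]]]].
exact: form_le_entries.
Qed.

Lemma opnorm_le f e :
  (forall y u v, l2norm u <= 1 -> l2norm v <= 1 ->
     normc (dot u (mxapp (ev f y) v)) <= e) ->
  opnorm f <= e.
Proof.
move=> he; apply: ge_sup; last by move=> _ [y [u [v [u1 v1 ->]]]]; exact: he.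
have z : l2norm (fun _ : 'I_m.+1 => 0 : C) <= 1.
  by rewrite /l2norm big1 ?sqrtr0// => i _; rewrite (normc0 R) expr0n.
by eexists; exists point, (fun=> 0), (fun=> 0).
Qed.

Lemma form_le_opnorm1 f y u v : l2norm u <= 1 -> l2norm v <= 1 ->
  normc (dot u (mxapp (ev f y) v)) <= opnorm f.
Proof.
by move=> u1 v1; apply: ub_le_sup; [exact: has_ubound_opnorm|exists y, u, v].
Qed.

Lemma opnorm_ge0 f : 0 <= opnorm f.
Proof.
have := @form_le_opnorm1 f point (fun i => (i == 0)%:R) (fun i => (i == 0)%:R).
by rewrite nrm_delta => /(_ (lexx _) (lexx _)); apply: le_trans; exact: normc_ge0.
Qed.

Lemma form_le_opnorm f y u v :
  normc (dot u (mxapp (ev f y) v)) <= opnorm f * l2norm u * l2norm v.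
Proof.
have [u0|un0] := eqVneq (l2norm u) 0.
  rewrite u0 mulr0 mul0r (nrm_eq0 u0) /dot big1 ?(normc0 R)// => i _.
  by rewrite rmorph0 mul0r.
have [v0|vn0] := eqVneq (l2norm v) 0.
  rewrite v0 mulr0 (nrm_eq0 v0) /dot big1 ?(normc0 R)// => i _.
  by rewrite /mxapp big1 ?mulr0// => j _; rewrite mulr0.
have up : 0 < l2norm u by rewrite lt_def un0 nrm_ge0.
have vp : 0 < l2norm v by rewrite lt_def vn0 nrm_ge0.
have := @form_le_opnorm1 f y
  (fun i => (l2norm u)^-1%:C%C * u i) (fun i => (l2norm v)^-1%:C%C * v i).
rewrite !nrmZ !ger0_norm ?invr_ge0 ?nrm_ge0// !mulVf// => /(_ (lexx _) (lexx _)).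
rewrite appZ dotZ !normcM normc_conj/= !expr0n !addr0 !sqrtr_sqr.
rewrite !ger0_norm ?invr_ge0 ?nrm_ge0// -invfM mulrC ler_pdivrMr ?mulr_gt0//.
by rewrite mulrA.
Qed.

(** Apply the bound on forms to the vectors [f v] and [v]. *)
Lemma nrm_app_le f y v : l2norm (mxapp (ev f y) v) <= opnorm f * l2norm v.
Proof.
set w := mxapp _ _.
have := @form_le_opnorm f y w v; rewrite normc_dotvv.
have [w0 _|wn0] := eqVneq (l2norm w) 0.
  by rewrite w0 mulr_ge0 ?opnorm_ge0 ?nrm_ge0.
by rewrite expr2 mulrAC ler_pM2r// lt_def wn0 nrm_ge0.
Qed.

Fact opnormD f g : opnorm (f + g) <= opnorm f + opnorm g.
Proof.
apply: opnorm_le => y u v u1 v1.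
rewrite (_ : dot _ _ = dot u (mxapp (ev f y) v) + dot u (mxapp (ev g y) v)).
  by apply: le_trans (le_normcD _ _) (lerD _ _); exact: form_le_opnorm1.
rewrite /dot -big_split/=; apply: eq_bigr => i _; rewrite -mulrDr; congr (_ * _).
by rewrite /mxapp -big_split/=; apply: eq_bigr => j _; rewrite -mulrDl evD mxE.
Qed.

Lemma formZ c M u v : dot u (mxapp (c *: M) v) = c * dot u (mxapp M v) :> C.
Proof.
rewrite /dot mulr_sumr; apply: eq_bigr => i _; rewrite mulrCA; congr (_ * _).
by rewrite /mxapp mulr_sumr; apply: eq_bigr => j _; rewrite mxE mulrA.
Qed.

Lemma opnormZ_le c f : opnorm (c *: f) <= normc c * opnorm f.
Proof.
apply: opnorm_le => y u v u1 v1; rewrite evZ formZ normcM.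
by rewrite ler_wpM2l ?normc_ge0//; exact: form_le_opnorm1.
Qed.

Fact opnormZ c f : opnorm (c *: f) = normc c * opnorm f.
Proof.
apply/eqP; rewrite eq_le opnormZ_le/=.
have [->|c0] := eqVneq c 0; first by rewrite (normc0 R) mul0r opnorm_ge0.
have nc0 : normc c != 0 by apply/eqP => /eq0_normc/eqP; exact/negP.
have := opnormZ_le c^-1 (c *: f); rewrite scalerA mulVf// scale1r normcV.
by rewrite mulrC ler_pdivlMr ?lt_def ?nc0 ?normc_ge0// mulrC.
Qed.

Lemma entry_le_opnorm f y i j : normc (ev f y i j) <= opnorm f.
Proof. by rewrite -dot_delta; apply: form_le_opnorm1; rewrite nrm_delta. Qed.

Fact opnorm_eq0 f : opnorm f = 0 -> f = 0.
Proof.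
move=> f0; apply: evP => y; apply/matrixP => i j; rewrite ev0 [RHS]mxE.
by apply: eq0_normc; apply/eqP; rewrite eq_le normc_ge0 andbT -f0 entry_le_opnorm.
Qed.

Fact opnormM f g : opnorm (f * g) <= opnorm f * opnorm g.
Proof.
apply: opnorm_le => y u v u1 v1; rewrite evM appM.
apply: le_trans (form_le_opnorm _ _ _ _) _; rewrite -mulrA.
rewrite ler_wpM2l ?opnorm_ge0//; apply: le_trans (ler_piMl (nrm_ge0 _) u1) _.
apply: le_trans (nrm_app_le _ _ _) _.
by rewrite ler_piMr ?opnorm_ge0.
Qed.

Lemma opnorm_star_le f : opnorm (star f) <= opnorm f.
Proof.
apply: opnorm_le => y u v u1 v1; rewrite ev_star dot_adj dotC normc_conj.
exact: form_le_opnorm1.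
Qed.

(** The nontrivial inequality: the form at [(u, v)] is at most |f v|, whose
    square is the form of [f* f] at [(v, v)]. *)
Fact opnormC f : opnorm (star f * f) = opnorm f ^+ 2.
Proof.
apply/eqP; rewrite eq_le; apply/andP; split.
  apply: le_trans (opnormM _ _) _; rewrite expr2.
  by rewrite ler_wpM2r ?opnorm_ge0// opnorm_star_le.
set e := opnorm (star f * f).
have e0 : 0 <= e by exact: opnorm_ge0.
rewrite -(sqr_sqrtr e0) ler_pXn2r ?nnegrE ?opnorm_ge0 ?sqrtr_ge0//.
apply: opnorm_le => y u v u1 v1; apply: le_trans (dot_le _ _) _.
apply: le_trans (ler_piMl (nrm_ge0 _) u1) _.
rewrite -[leLHS]ger0_norm ?nrm_ge0// -sqrtr_sqr ler_wsqrtr//.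
rewrite -normc_dotvv -dot_adj -appM -ev_star.
rewrite (_ : _ *m _ = ev (star f * f) y); last by rewrite evM.
exact: form_le_opnorm1.
Qed.

Fact cmat_complete (u : nat -> B) :
  (forall e, 0 < e -> exists N, forall k n, (N <= k)%N -> (N <= n)%N ->
     opnorm (u k - u n) < e) ->
  exists l, opnorm (u n - l) @[n --> \oo] --> 0.
Proof.
move=> uc.
have /choice[l hl] (ij : 'I_m.+1 * 'I_m.+1) : exists l : contfun X C,
    forall e : R, 0 < e -> exists N, forall n, (N <= n)%N ->
    forall x, normc (contfun_val (u n ij.1 ij.2) x - contfun_val l x) <= e.
  apply: (@contfun_cauchy _ _ (fun n => u n ij.1 ij.2)) => e /uc[N hN].
  exists N => k n Nk Nn x; apply: le_lt_trans (hN k n Nk Nn).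
  by have := entry_le_opnorm (u k - u n) x ij.1 ij.2; rewrite !mxE.
exists (\matrix_(i, j) l (i, j)); apply/cvgrPdist_le => e e0.
have s0 : 0 < e / (m.+1 * m.+1)%:R by rewrite divr_gt0// ltr0n.
have /choice[N hN] ij := hl ij _ s0.
exists (\max_ij N ij)%N => // n /= Nn.
rewrite sub0r normrN ger0_norm ?opnorm_ge0//.
apply: opnorm_le => y v w v1 w1.
have -> : e = e / (m.+1 * m.+1)%:R *+ m.+1 *+ m.+1.
  by rewrite -mulrnA -[RHS]mulr_natr divfK// pnatr_eq0 muln_eq0.
apply: form_le_entries => // i j; rewrite !mxE; apply: (hN (i, j)).
by apply: leq_trans Nn; exact: leq_bigmax.
Qed.

HB.instance Definition _ := StarAlgebra_isCStarAlgebra.Build R B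
  opnormD opnormZ opnorm_eq0 opnormM opnormC cmat_complete.

End MatrixFunctions.

(** * The unit circle and roots of unity *)

Section Cis.
Context (R : realType).
Local Notation C := R[i].

Definition cis (a : R) : C := Complex (cos a) (sin a).

Lemma cisD a b : cis (a + b) = cis a * cis b.
Proof. by rewrite /cis cosD sinD; congr Complex; ring. Qed.

Lemma cis0 : cis 0 = 1.
Proof. by rewrite /cis cos0 sin0. Qed.

Lemma cisMn a n : cis (a *+ n) = cis a ^+ n.
Proof. by elim: n => [|n IH]; rewrite ?cis0// mulrS exprS cisD IH. Qed.

Lemma normc_cis a : normc (cis a) = 1.
Proof. by rewrite /= cos2Dsin2 sqrtr1. Qed.

Lemma cis2pi : cis (2 * pi) = 1.
Proof. by rewrite /cis mulr_natl cos2pi sin2pi. Qed.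

(** By the half-angle formula, [cos a = 1 - 2 * sin (a / 2) ^+ 2]. *)
Lemma cis_neq1 a : 0 < a < 2 * pi -> cis a != 1.
Proof.
move=> /andP[a0 a2]; apply/eqP => /(congr1 (@complex.Re R))/= ca.
have s0 : 0 < sin (a / 2).
  by apply: sin_gt0_pi; rewrite divr_gt0//= ltr_pdivrMr// mulrC.
move: ca; rewrite [a in cos a](_ : _ = (a / 2) *+ 2); last first.
  by rewrite -mulr_natr divfK.
rewrite cos_mulr2n cos2sin2 => h; have : sin (a / 2) ^+ 2 = 0 by lra.
by move/eqP; rewrite sqrf_eq0; move: s0 => /[swap]/eqP ->; rewrite ltxx.
Qed.

Lemma expi2piE (x : R) : expi2pi x = cis (2 * pi * x).
Proof. by []. Qed.

Lemma expi2pi_prim (q : nat) : (0 < q)%N -> q.-primitive_root (expi2pi (q%:R^-1 : R)).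
Proof.
move=> q0; have qr : q%:R != 0 :> R by rewrite pnatr_eq0 -lt0n.
apply/andP; split=> //; apply/forallP => i; apply/eqP.
rewrite unity_rootE expi2piE -cisMn.
have -> : 2 * pi * q%:R^-1 *+ i.+1 = 2 * pi * (i.+1%:R / q%:R) :> R.
  by rewrite -[LHS]mulr_natr -mulrA [q%:R^-1 * _]mulrC.
have [->|neqi] := eqVneq i.+1 q; first by rewrite divff// mulr1 cis2pi eqxx.
apply/negbTE/cis_neq1; rewrite mulr_gt0 ?mulr_gt0 ?pi_gt0 ?divr_gt0 ?invr_gt0 ?ltr0n//=.
rewrite gtr_pMr ?mulr_gt0 ?pi_gt0// ltr_pdivrMr ?ltr0n// mul1r ltr_nat.
by rewrite ltn_neqAle neqi ltn_ord.
Qed.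

(** The principal q-th root on the right half of the unit circle, where the
    argument of a point is the arcsine of its imaginary part. *)
Definition cis_root (q : nat) (z : C) : C := cis (asin (complex.Im z) / q%:R).

Lemma cis_root1 q : cis_root q 1 = 1.
Proof.
rewrite /cis_root/= -[X in asin X](@sin0 R) sinK ?mul0r ?cis0//.
by rewrite in_itv/= oppr_le0 divr_ge0 ?pi_ge0.
Qed.

Lemma half_circle_Im (z : C) : normc z = 1 -> 0 < complex.Re z ->
  -1 < complex.Im z < 1.
Proof.
case: z => a b /= z1 a0; rewrite -ltr_norml -sqrtr_sqr -z1 ltr_sqrt.
  by rewrite ltrDr exprn_gt0.
by rewrite ltr_wpDr ?sqr_ge0// exprn_gt0.
Qed.

Lemma cis_rootX (q : nat) (z : C) : (0 < q)%N -> normc z = 1 ->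
  0 < complex.Re z -> cis_root q z ^+ q = z.
Proof.
move=> q0 z1 a0; have /andP[b1 b2] := half_circle_Im z1 a0.
have b12 : -1 <= complex.Im z <= 1 by rewrite !ltW.
rewrite /cis_root -cisMn -[X in cis X]mulr_natr divfK ?pnatr_eq0 -?lt0n//.
rewrite /cis cos_asin// asinK ?in_itv//=; case: z z1 a0 {b1 b2 b12} => a b /= z1 a0.
congr Complex; have -> : 1 - b ^+ 2 = a ^+ 2.
  have : Num.sqrt (a ^+ 2 + b ^+ 2) ^+ 2 = 1 by rewrite z1 expr1n.
  by rewrite sqr_sqrtr ?addr_ge0 ?sqr_ge0// => <-; rewrite addrK.
by rewrite sqrtr_sqr ger0_norm// ltW.
Qed.

Lemma cvg_cis (T : Type) (F : set_system T) {FF : Filter F} (f : T -> R) (l : R) :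
  f @ F --> l -> (fun t => cis (f t)) @ F --> (cis l : C^o).
Proof.
move=> fl; apply: cvgcRI.
  by apply: (@cvg_comp _ _ _ f cos _ (nbhs l) _ fl); exact: continuous_cos.
by apply: (@cvg_comp _ _ _ f sin _ (nbhs l) _ fl); exact: continuous_sin.
Qed.

Lemma cvg_cis_root q (T : Type) (F : set_system T) {FF : Filter F} (f : T -> C) (l : C) :
  normc l = 1 -> 0 < complex.Re l ->
  f @ F --> (l : C^o) -> (fun t => cis_root q (f t)) @ F --> (cis_root q l : C^o).
Proof.
move=> l1 l0 fl; apply: cvg_cis; apply: cvgM; last exact: cvg_cst.
apply: (@cvg_comp _ _ _ (fun t => complex.Im (f t)) (@asin R) _ (nbhs (complex.Im l)) _).
  exact: cvg_Im.
exact/continuous_asin/half_circle_Im.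
Qed.

Lemma near1_Re (z : C) : normc (z - 1) < 1 -> 0 < complex.Re z.
Proof.
move=> /(le_lt_trans (Re_le_normc _)); rewrite raddfB/= ltr_norml => /andP[h _].
lra.
Qed.

End Cis.

(** * The homotopy argument *)

Section Homotopy.
Context (R : realType).
Local Notation C := R[i].

(** Uniform continuity on the unit square, in the only form that is used: along
    the second coordinate. *)
Lemma unif_cont_square (F : R * R -> C) (e : R) :
  continuous (F : R * R -> C^o) -> 0 < e ->
  exists N : nat, forall t x x', 0 <= t <= 1 -> 0 <= x <= 1 ->
    `|x - x'| <= N.+1%:R^-1 -> normc (F (t, x) - F (t, x')) < e.
Proof.
move=> Fc e0; pose K := (`[0, 1] `*` `[0, 1] : set (R * R)).
have cK : compact K by apply: compact_setX; exact: segment_compact.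
pose P (N : nat) (p : R * R) := forall x', `|p.2 - x'| <= N.+1%:R^-1 ->
  normc (F p - F (p.1, x')) < e.
suff: \forall N \near \oo, K `<=` P N.
  move=> [N _ hN]; exists N => t x x' t01 x01 xx'.
  by apply: (hN N (leqnn _) (t, x)) => //; split.
apply: ((compact_near_coveringP K).1 cK) => -[t x] _.
have e2 : 0 < e / 2 by rewrite divr_gt0.
have /cvgcP/(_ _ e2)/nbhs_ballP[d d0 hd] := Fc (t, x).
have d2 : 0 < d / 2 by rewrite divr_gt0.
exists (ball (t, x) (d / 2), [set N | N.+1%:R^-1 < d / 2]).
  split; [exact: nbhsx_ballx|].
  exact: near_infty_natSinv_lt (PosNum d2).
move=> [[t1 x1] N] /= [[t1b x1b] Nd] x' x1x'.
rewrite -(subrK (F (t, x)) (F (t1, x1))) -addrA.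
apply: le_lt_trans (le_normcD _ _) _; rewrite [ltRHS]splitr ltrD//.
  rewrite -normcN opprB; apply: hd; split; apply: le_ball t1b || apply: le_ball x1b.
  - by rewrite ler_pdivrMr// ler_pMr// ler1n.
  - by rewrite ler_pdivrMr// ler_pMr// ler1n.
apply: hd; split.
  by apply: le_ball t1b; rewrite ler_pdivrMr// ler_pMr// ler1n.
rewrite (splitr d); apply: ball_triangle x1b _.
by rewrite -ball_normE/=; exact: le_lt_trans Nd.
Qed.

(** For a loop [h] in the circle this says that its winding number is a multiple
    of [q]. In this form the property is stable under finite products without
    any lifting theory. The root is required to be continuous on the whole
    line, which avoids subspace topologies. *)
Definition loop_root (q : nat) (h : R -> C) := exists g : R -> C,
  [/\ continuous (g : R -> C^o), g 0 = 1, g 1 = 1 &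
      forall t, 0 <= t <= 1 -> h t = g t ^+ q].

Lemma loop_root_prod q (I : Type) (r : seq I) (h : I -> R -> C) :
  (forall i, loop_root q (h i)) -> loop_root q (fun t => \prod_(i <- r) h i t).
Proof.
move=> hr; elim: r => [|i r [g [gc g0 g1 gh]]].
  exists (fun=> 1); split=> //; first by move=> x; exact: cvg_cst.
  by move=> t _; rewrite big_nil expr1n.
have [g' [gc' g0' g1' gh']] := hr i.
exists (fun t => g' t * g t); split; last 3 first.
- by rewrite g0 g0' mulr1.
- by rewrite g1 g1' mulr1.
- by move=> t t01; rewrite big_cons gh// gh'// exprMn.
by move=> x; apply: (@cvgM C); [exact: gc'|exact: gc].
Qed.

Definition clampr (x : R) : R := Num.max 0 (Num.min x 1).

Lemma clampr_id x : 0 <= x <= 1 -> clampr x = x.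
Proof. by move=> /andP[x0 x1]; rewrite /clampr min_l// max_r. Qed.

Lemma clampr_itv x : 0 <= clampr x <= 1.
Proof. by rewrite /clampr le_max lexx/= ge_max ler01/= ge_min lexx orbT. Qed.

Lemma clampr_continuous : continuous clampr.
Proof.
move=> x; have mc : {for x, continuous ((id : R -> R^o) \min (fun=> 1))}.
  by apply: continuous_min; [exact: cvg_id|exact: cvg_cst].
have := continuous_max (cvg_cst (0 : R^o)) mc.
exact.
Qed.

(** A loop that stays in the right half of the circle is contractible there; its
    principal root does the job. *)
Lemma loop_root_near1 (q : nat) (h : R -> C) : (0 < q)%N ->
  continuous (h : R -> C^o) -> h 0 = 1 -> h 1 = 1 ->
  (forall t, 0 <= t <= 1 -> normc (h t) = 1 /\ normc (h t - 1) < 1) ->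
  loop_root q h.
Proof.
move=> q0 hc h0 h1 hh; exists (fun t => cis_root q (h (clampr t))); split.
- move=> t; have [n1 /near1_Re r0] := hh _ (clampr_itv t).
  apply: cvg_cis_root => //.
  exact: (@continuous_comp _ _ C^o clampr h t (@clampr_continuous t) (hc _)).
- by rewrite clampr_id ?lexx ?ler01// h0 cis_root1.
- by rewrite clampr_id ?lexx ?ler01// h1 cis_root1.
- move=> t t01; have [n1 /near1_Re r0] := hh _ t01.
  by rewrite clampr_id// cis_rootX.
Qed.

(** If two paths in the circle are homotopic relative to their ends, their
    quotient is a finite product of loops close to 1: cut the homotopy into
    slices thin enough for consecutive paths to be at distance less than 1. *)
Lemma loop_root_homotopy (q : nat) (F : R * R -> C) : (0 < q)%N ->
  continuous (F : R * R -> C^o) -> (forall p, normc (F p) = 1) ->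
  (forall x, F (0, x) = F (0, 0)) -> (forall x, F (1, x) = F (1, 0)) ->
  exists2 h, loop_root q h & forall t, F (t, 1) = F (t, 0) * h t.
Proof.
move=> q0 Fc F1 F0x F1x.
have [N hN] := unif_cont_square Fc (@ltr01 R).
have FJ p : F p * (F p)^* = 1 by rewrite mulrC mul_conjc F1 expr1n.
pose x j : R := j%:R / N.+1%:R.
pose s (j : 'I_N.+1) t := F (t, x j.+1) * (F (t, x j))^*.
have slice y : continuous ((fun t => F (t, y)) : R -> C^o).
  move=> t; apply: (@continuous_comp _ _ C^o (fun t => (t, y)) F t); last exact: Fc.
  exact: (cvg_pair cvg_id (cvg_cst _)).
have xS j : `|x j.+1 - x j| <= N.+1%:R^-1.
  by rewrite /x -mulrBl -natrB// subSnn mul1r ger0_norm// invr_ge0.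
have x01 (j : nat) : (j <= N.+1)%N -> 0 <= x j <= 1.
  move=> jN; rewrite /x divr_ge0//= ler_pdivrMr// mul1r ler_nat//.
exists (fun t => \prod_j s j t).
  apply: loop_root_prod => j; apply: loop_root_near1 => //.
  - move=> t; apply: (@cvgM C); first exact: slice.
    apply/cvgcP => e e0; have /cvgcP/(_ _ e0) := slice (x j) t.
    by apply: filterS => y; rewrite -rmorphB normc_conj.
  - by rewrite /s !(F0x (x _)).
  - by rewrite /s !(F1x (x _)).
  move=> t t01; split; first by rewrite normcM normc_conj !F1 mulr1.
  rewrite -(FJ (t, x j)) -mulrBl normcM normc_conj F1 mulr1.
  by apply: hN; rewrite ?xS// x01.
move=> t; have tel n : (n <= N.+1)%N ->
    F (t, x n) = F (t, 0) * \prod_(j < n) (F (t, x j.+1) * (F (t, x j))^*).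
  elim: n => [|n IH] nN; first by rewrite big_ord0 mulr1 /x mul0r.
  by rewrite big_ord_recr/= mulrA -IH 1?ltnW// mulrCA FJ mulr1.
by have := tel _ (leqnn _); rewrite {1}/x divff// pnatr_eq0.
Qed.

Lemma small_not_mem (s : seq R) (b : R) : 0 < b -> exists2 v, 0 < v <= b & v \notin s.
Proof.
move=> b0; suff [v /andP[v0 vb] hv] : exists2 v, 0 < v <= b &
    forall x, x \in s -> 0 < x -> v < x.
  by exists v; rewrite ?v0//; apply/negP => /hv/(_ v0); rewrite ltxx.
elim: s => [|x s [v /andP[v0 vb] hv]]; first by exists b; rewrite ?b0/=.
have [x0|x0] := ltP 0 x; last first.
  exists v; rewrite ?v0// => y; rewrite inE => /orP[/eqP ->|/hv//].
  by move=> /(le_lt_trans x0); rewrite ltxx.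
exists (Num.min v (x / 2)).
  by rewrite lt_min v0 divr_gt0//= ge_min vb.
move=> y; rewrite inE => /orP[/eqP -> _|ys y0]; rewrite gt_min.
  by rewrite ltr_pdivrMr// ltr_pMr// ltr1n orbT.
by rewrite hv.
Qed.

(** The quotient of [f] by the given root of [f ^+ q] takes its values in the
    finite set of q-th roots of unity, so that it is constant. This is seen on
    the distance between [f] and that root: it takes finitely many values,
    vanishes at 1 and is continuous. *)
Lemma loop_root_endpoint (q : nat) (f : R -> C) : (0 < q)%N ->
  continuous (f : R -> C^o) -> (forall t, normc (f t) = 1) ->
  loop_root q (fun t => f t ^+ q) -> f 1 = 1 -> f 0 = 1.
Proof.
move=> q0 fc f1 [g [gc g0 g1 fg]] f11; apply/eqP; apply/negPn/negP => f01.
pose w : C := expi2pi (q%:R^-1 : R).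
pose s t := normc (f t - g t).
have sc : {within `[0, 1], continuous s}.
  apply: continuous_subspaceT => t; apply: cvg_normc.
  by apply: (@cvgB C C^o); [exact: fc|exact: gc].
have s0 : 0 < s 0.
  rewrite lt_def normc_ge0 andbT; apply/eqP => /eq0_normc/eqP.
  by rewrite g0 subr_eq0; exact/negP.
have [v /andP[v0 vs] /negP] :=
  small_not_mem [seq normc (w ^+ i - 1) | i <- iota 0 q] s0.
apply.
have s1 : s 1 = 0 by rewrite /s f11 g1 subrr (normc0 R).
have [|t] := IVT (@ler01 R) sc (v := v).
  by rewrite s1 ge_min le_max vs andbT (ltW v0) orbT.
rewrite in_itv/= => t01 <-.
have gn : normc (g t) = 1.
  have : normc (g t) ^+ q = 1.
    by rewrite -normcX -fg// normcX f1 expr1n.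
  by move/eqP; rewrite pexpr_eq1 ?normc_ge0// => /eqP.
have gJ : g t * (g t)^* = 1 by rewrite mulrC mul_conjc gn expr1n.
have : (f t * (g t)^*) ^+ q = 1 by rewrite exprMn fg// -exprMn gJ expr1n.
move=> /(prim_rootP (expi2pi_prim R q0))[i ei].
apply/mapP; exists (i : nat); first by rewrite mem_iota add0n ltn_ord.
rewrite -ei /s -[RHS]mulr1 -gn -normcM mulrBl mul1r -mulrA [_^* * _]mulrC gJ mulr1//.
Qed.

(** For each [k] the quotient of [rho k (t, 1)] by [rho k (t, 0)] has a loop root
    by [loop_root_homotopy]. The cyclic shift then makes all the paths
    [rho k (t, 0)] equal up to factors that have loop roots, and as their product
    is 1, the q-th power of each has a loop root. As such a path runs from [z] to
    1, [loop_root_endpoint] gives [z = 1]. *)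
Theorem no_homotopy (m : nat) (rho : 'I_m.+2 -> R * R -> C) (z : C) :
  (forall k, continuous (rho k : R * R -> C^o)) ->
  (forall k p, normc (rho k p) = 1) ->
  (forall p, \prod_k rho k p = 1) ->
  (forall k t, rho (k + 1) (t, 1) = rho k (t, 0)) ->
  (forall k x, rho k (0, x) = z) -> (forall k x, rho k (1, x) = 1) ->
  z = 1.
Proof.
move=> rc r1 rprod rshift r0x r1x; pose q := m.+2.
have /choice[H hH] (n : nat) : exists H, loop_root q H /\
    forall t, rho 0 (t, 0) = rho n%:R (t, 0) * H t.
  elim: n => [|n [H [nH hH]]].
    exists (fun=> 1); split; last by move=> t; rewrite mulr1.
    exists (fun=> 1); split=> // [x|t _]; first exact: cvg_cst.
    by rewrite expr1n.
  have [h nh hh] : exists2 h, loop_root q h &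
      forall t, rho n.+1%:R (t, 1) = rho n.+1%:R (t, 0) * h t.
    by apply: loop_root_homotopy => // x; rewrite ?r0x ?r1x.
  exists (fun t => h t * H t); split; last first.
    by move=> t; rewrite hH mulrA -hh -natr1 rshift.
  have := @loop_root_prod q bool [:: true; false] (fun b => if b then h else H).
  case=> [[]//|g [gc g0 g1 gh]]; exists g; split=> // t t01.
  by rewrite -gh// !big_cons big_nil mulr1.
rewrite -(r0x 0 0); apply: (@loop_root_endpoint q (fun t => rho 0 (t, 0))) => //.
- move=> t; apply: (@continuous_comp _ _ C^o (fun t => (t, 0)) (rho 0) t); last exact: rc.
  exact: (cvg_pair cvg_id (cvg_cst _)).
have := @loop_root_prod q 'I_q (enum 'I_q) (fun k => H k) (fun k => (hH k).1).
case=> g [gc g0 g1 gh]; exists g; split=> // t t01.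
rewrite -gh//; transitivity (\prod_(k < q) (rho k (t, 0) * H k t)).
  rewrite -[in LHS](card_ord q) -prodr_const; apply: eq_bigr => k _.
  by rewrite (hH k).2; congr (rho _ _ * _); rewrite natr_Zp.
by rewrite big_split/= rprod mul1r big_enum.
Qed.

End Homotopy.

(** * Shift and clock matrices *)

Section CyclicShift.
Context (R : realType) (m : nat).
Local Notation C := R[i].
Local Notation q := (m.+2).
Local Notation Mq := ('M[C]_q).
Implicit Types (M N : Mq) (i j k : 'I_q) (z w : C).

Lemma expr_ordS z k : z ^+ q = 1 -> z ^+ (k + 1)%R = z * z ^+ k.
Proof. by move=> zq; rewrite /= expr_mod// addn1 exprS. Qed.

Definition shift z : Mq := \matrix_(i, j) ((i == j + 1)%:R * z ^+ j).
Definition clock w : Mq := diag_mx (\row_i w ^+ i).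

Lemma shift_mull z M i j : (shift z * M) (i + 1) j = z ^+ i * M i j.
Proof.
rewrite mxE (bigD1 i)//= big1 ?addr0 => [|k ki]; first by rewrite mxE eqxx mul1r.
by rewrite mxE (inj_eq (addIr _)) eq_sym (negPf ki) !mul0r.
Qed.

Lemma shift_mulr z M i j : (M * shift z) i j = M i (j + 1) * z ^+ j.
Proof.
rewrite mxE (bigD1 (j + 1))//= big1 ?addr0 => [|k /negPf kj]; last first.
  by rewrite mxE kj mul0r mulr0.
by rewrite mxE eqxx mul1r.
Qed.

Lemma clock_mull w M i j : (clock w * M) i j = w ^+ i * M i j.
Proof. by rewrite -[LHS]/((diag_mx _ *m M) i j) mul_diag_mx !mxE. Qed.

Lemma clock_mulr w M i j : (M * clock w) i j = M i j * w ^+ j.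
Proof. by rewrite -[LHS]/((M *m diag_mx _) i j) mul_mx_diag !mxE. Qed.

Lemma mx_eqS M N : (forall i j, M (i + 1) j = N (i + 1) j) -> M = N.
Proof. by move=> MN; apply/matrixP => i j; rewrite -(subrK 1 i) MN. Qed.

Lemma shift_comm z : z ^+ q = 1 -> shift z * shift 1 = z *: (shift 1 * shift z).
Proof.
move=> zq; apply: mx_eqS => i j; rewrite [RHS]mxE !shift_mull !mxE !expr1n mulr1 mul1r.
by case: eqP => [->|_]; rewrite ?mulr0 ?mul0r ?mulr0// mulr1 mul1r expr_ordS.
Qed.

Lemma clock_shift w z : w ^+ q = 1 -> clock w * shift z = w *: (shift z * clock w).
Proof.
move=> wq; apply/matrixP => i j; rewrite [RHS]mxE clock_mull clock_mulr !mxE.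
by case: eqP => [->|_]; rewrite ?mul0r ?mulr0// mul1r expr_ordS//; ring.
Qed.

Lemma expr_conj z k : normc z = 1 -> (z ^+ k)^* * z ^+ k = 1.
Proof. by move=> z1; rewrite mul_conjc normcX z1 !expr1n. Qed.

Lemma shift_unitary z : normc z = 1 -> adj (shift z) * shift z = 1.
Proof.
move=> z1; apply/matrixP => i j; rewrite shift_mulr !mxE rmorphM/= conjC_nat.
rewrite (inj_eq (addIr _)) eq_sym; case: eqP => [->|_]; last by rewrite !mul0r.
by rewrite mul1r expr_conj.
Qed.

Lemma clock_unitary w : normc w = 1 -> adj (clock w) * clock w = 1.
Proof.
move=> w1; apply/matrixP => i j; rewrite clock_mulr !mxE.
by case: eqVneq => _; rewrite ?mulr1n ?expr_conj// mulr0n rmorph0 mul0r.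
Qed.

Lemma unitaryC M : adj M * M = 1 -> M * adj M = 1.
Proof. exact: mulmx1C. Qed.

(** An eigenvector of the conjugation by the clock matrix, for the eigenvalue
    [w], is a weighted cyclic shift. *)
Lemma clock_eigen w M i j : q.-primitive_root w ->
  clock w * M = w *: (M * clock w) -> i != j + 1 -> M i j = 0.
Proof.
move=> wp cM ij; have h : w ^+ i * M i j = w * (M i j * w ^+ j).
  by rewrite -clock_mull cM mxE clock_mulr.
have wq := prim_expr_order wp.
have /eqP : (w ^+ i - w ^+ (j + 1)%R) * M i j = 0.
  by rewrite mulrBl h expr_ordS//; ring.
rewrite mulf_eq0 subr_eq0 (eq_prim_root_expr wp) !modn_small ?ltn_ord//.
case/orP => [/eqP eij|/eqP//]; case/eqP: ij; exact: val_inj.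
Qed.

Section Family.
Context (n : nat) (w : C) (wp : q.-primitive_root w).
Implicit Types a : 'I_n -> Mq.

Definition clock_family a : Prop :=
  [/\ forall i j : 'I_n, a i * a j = a j * a i, \sum_i a i * adj (a i) = 1 &
      forall i : 'I_n, clock w * a i = w *: (a i * clock w)].

(** For a commuting family of weighted shifts, the weights of the [a i] along the
    edge from [k] to [k + 1] of the cycle form a unit vector, and commutation
    says that the vectors of consecutive edges are proportional. Their inner
    product is the factor of proportionality. *)
Definition ratio a k : C := \sum_i (a i (k + 1) k)^* * a i (k + 1 + 1) (k + 1).

Lemma family_mul a (i : 'I_n) M j k :
  clock_family a -> (a i * M) (j + 1) k = a i (j + 1) j * M j k.
Proof.
case=> _ _ aw; rewrite mxE (bigD1 j)//= big1 ?addr0// => l lj.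
by rewrite (clock_eigen wp (aw i)) ?mul0r// (inj_eq (addIr _)) eq_sym.
Qed.

Lemma family_norm a k : clock_family a -> \sum_i (a i (k + 1) k)^* * a i (k + 1) k = 1.
Proof.
move=> ha; have [_ a1 _] := ha.
transitivity ((\sum_i a i * adj (a i)) (k + 1) (k + 1)); last first.
  by rewrite a1 mxE eqxx.
by rewrite summxE; apply: eq_bigr => i _; rewrite family_mul// [adj _ _ _]mxE mulrC.
Qed.

Lemma family_ratio a (i : 'I_n) k : clock_family a ->
  a i (k + 1 + 1) (k + 1) = ratio a k * a i (k + 1) k.
Proof.
move=> ha; have [ac _ _] := ha.
rewrite -[LHS]mul1r -(family_norm k ha) !mulr_suml; apply: eq_bigr => j _.
have /matrixP/(_ (k + 1 + 1) k) := ac i j; rewrite !family_mul// => h.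
by rewrite -mulrA [_ * a i _ _]mulrC h mulrA.
Qed.

Lemma ratio_norm a k : clock_family a -> normc (ratio a k) = 1.
Proof.
move=> ha; have h : (ratio a k)^* * ratio a k = 1.
  rewrite -(family_norm (k + 1) ha).
  under eq_bigr do rewrite !(family_ratio _ _ ha) rmorphM/= mulrACA.
  by rewrite -mulr_sumr family_norm ?mulr1.
apply/eqP; rewrite -(@pexpr_eq1 _ _ 2)// ?normc_ge0//; apply/eqP/complexI.
by rewrite -mul_conjc h.
Qed.

(** Going once around the cycle multiplies the unit vector of weights by the
    product of all ratios, and brings it back to itself. *)
Lemma ratio_prod a : clock_family a -> \prod_k ratio a k = 1.
Proof.
move=> ha.
have step (l : nat) (i : 'I_n) : a i (l%:R + 1) l%:R =
    \prod_(k < l) ratio a k%:R * a i (0 + 1) 0.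
  elim: l => [|l IH]; first by rewrite big_ord0 mul1r.
  by rewrite -natr1 family_ratio// IH big_ord_recr/= mulrA [_ * \prod_(_ < _) _]mulrC.
have E (i : 'I_n) : a i (0 + 1) 0 = \prod_k ratio a k * a i (0 + 1) 0.
  have q0 : q%:R = 0 :> 'I_q by exact: (@pchar_Zp q).
  have := step q i; rewrite q0 => {1}->; congr (_ * _).
  by apply: eq_bigr => k _; rewrite natr_Zp.
move: (\prod_k _) E => P E; have <- := family_norm 0 ha.
rewrite -[LHS]mulr1 -{1}(family_norm 0 ha) mulr_sumr.
by apply: eq_bigr => i _; rewrite mulrCA -E.
Qed.

(** Conjugation by a shift moves every edge of the cycle to the next one, and
    its phases contribute the same factor [z] to all pairs of consecutive
    edges. *)
Lemma ratio_conj a b z k : normc z = 1 -> z ^+ q = 1 ->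
  (forall i : 'I_n, b i * shift z = shift z * a i) -> ratio b (k + 1) = ratio a k.
Proof.
move=> z1 zq ba.
have E (i : 'I_n) j : b i (j + 1 + 1) (j + 1) = z * a i (j + 1) j.
  have /matrixP/(_ (j + 1 + 1) j) := ba i; rewrite shift_mulr shift_mull expr_ordS//.
  rewrite mulrAC; apply: mulIf; rewrite expf_neq0//; apply: contra_eq_neq z1 => ->.
  by rewrite (normc0 R) eq_sym oner_eq0.
have zz : z^* * z = 1 by rewrite mul_conjc z1 expr1n.
by apply: eq_bigr => i _; rewrite !E rmorphM/= mulrACA zz mul1r.
Qed.

(** If the family commutes with a shift, its weights are proportional to those
    of the shift. *)
Lemma ratio_comm a z k : normc z = 1 -> z ^+ q = 1 -> clock_family a ->
  (forall i : 'I_n, a i * shift z = shift z * a i) -> ratio a k = z.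
Proof.
move=> z1 zq ha az.
have E (i : 'I_n) : a i (k + 1 + 1) (k + 1) = z * a i (k + 1) k.
  have /matrixP/(_ (k + 1 + 1) k) := az i; rewrite shift_mulr shift_mull expr_ordS//.
  rewrite mulrAC; apply: mulIf; rewrite expf_neq0//; apply: contra_eq_neq z1 => ->.
  by rewrite (normc0 R) eq_sym oner_eq0.
rewrite /ratio; under eq_bigr do rewrite E mulrCA.
by rewrite -mulr_sumr family_norm ?mulr1.
Qed.

End Family.
End CyclicShift.

(** * Star homomorphisms and the universal property *)

Section StarMorphisms.
Context (K : numClosedFieldType).

(** A property of bare functions, so that composites and conjugations do not have
    to be equipped with morphism structures before they are compared. *)
Definition star_hom (A B : starAlgType K) (f : A -> B) : Prop :=
  [/\ linear f, monoid_morphism f & star_preserving f].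

Lemma star_hom_lrmorphism (A B : starAlgType K) (f : {lrmorphism A -> B}) :
  star_preserving f -> star_hom f.
Proof.
move=> fs; split=> //; first exact: linearP.
by split=> [|x y]; rewrite ?rmorph1 ?rmorphM.
Qed.

Lemma star_hom_comp (A B D : starAlgType K) (g : B -> D) (f : A -> B) :
  star_hom g -> star_hom f -> star_hom (g \o f).
Proof.
move=> [gl [g1 gM] gs] [fl [f1 fM] fs]; split=> [c x y||x] /=.
- by rewrite fl gl.
- by split=> [|x y] /=; rewrite ?f1 ?g1 ?fM ?gM.
- by rewrite fs gs.
Qed.

Lemma star_hom_inner (A : starAlgType K) (u : A) :
  star u * u = 1 -> u * star u = 1 -> star_hom (fun x => u * x * star u).
Proof.
move=> hu hu'; split=> [c x y||x].
- by rewrite mulrDr mulrDl -scalerAr -scalerAl.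
- split=> [|x y]; first by rewrite mulr1.
  by rewrite !mulrA -[_ * star u * u]mulrA hu mulr1.
- by rewrite !starM starK mulrA.
Qed.

Lemma star_homZ (A B : starAlgType K) (f : A -> B) c x :
  star_hom f -> f (c *: x) = c *: f x.
Proof.
move=> [fl _ _]; have f0 : f 0 = 0.
  by have := fl (-1) 0 0; rewrite scaler0 addr0 scaleN1r addNr.
by have := fl c x 0; rewrite !addr0 f0 addr0.
Qed.

End StarMorphisms.

Section Sphere.
Context (R : realType) (theta : R).
Local Notation C := R[i].

Lemma sphere3_rel_hom (A B : starAlgType C) (f : A -> B) (z1 z2 : A) :
  star_hom f -> sphere3_rel theta z1 z2 -> sphere3_rel theta (f z1) (f z2).
Proof.
move=> hf [h1 h2 h3 h4]; have [fl [f1 fM] fs] := hf.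
split; rewrite -?fs -?fM; [by rewrite h1|by rewrite h2|by rewrite -star_homZ// h3|].
rewrite -f1 -h4; have := fl 1 (z1 * star z1) (z2 * star z2).
by rewrite !scale1r => ->.
Qed.

Lemma lrmorphism_of (A B : starAlgType C) (f : A -> B) : star_hom f ->
  exists2 F : {lrmorphism A -> B}, star_preserving F & F =1 f.
Proof.
move=> [fl fm fs].
pose F : {lrmorphism A -> B} := HB.pack_for {lrmorphism A -> B} f
  (GRing.isLinear.Build C A B *:%R f fl) (GRing.isMonoidMorphism.Build A B f fm).
exists F; [exact: fs|move=> x; reflexivity].
Qed.

(** The uniqueness half of the universal property, freed from the requirement
    that the images of the generators be named in advance. *)
Lemma sphere3_ext (A B : cstarAlgType R) (z1 z2 : A) (f f' : A -> B) :
  is_sphere3 theta z1 z2 -> star_hom f -> star_hom f' ->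
  f z1 = f' z1 -> f z2 = f' z2 -> f =1 f'.
Proof.
move=> [zrel zuniv] hf hf' e1 e2.
have [F Fs Ff] := lrmorphism_of hf; have [F' Fs' Ff'] := lrmorphism_of hf'.
have [_ uniq] := zuniv B (f z1) (f z2) (sphere3_rel_hom hf zrel).
by move=> x; rewrite -Ff -Ff'; apply: uniq; rewrite ?Ff ?Ff' ?e1 ?e2.
Qed.

End Sphere.

(** * The square, constant functions and coordinates of the join *)

(** The parameter space of the homotopy as a type: functions on it can be pulled
    back to the plane along the retraction [to_square]. *)
Definition unit_itv (R : realType) : Type := set_type `[(0 : R), 1]%classic.
HB.instance Definition _ R := Topological.on (unit_itv R).

Definition to_unit_itv (R : realType) (x : R) : unit_itv R :=
  SigSub (mem_set (clampr_itv x) : clampr x \in `[(0 : R), 1]%classic).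
HB.instance Definition _ (R : realType) := isPointed.Build (unit_itv R) (to_unit_itv 0).

Definition square (R : realType) : Type := (unit_itv R * unit_itv R)%type.
HB.instance Definition _ R := Topological.on (square R).
HB.instance Definition _ (R : realType) :=
  isPointed.Build (square R) (to_unit_itv 0, to_unit_itv 0).

Section Square.
Context (R : realType).
Local Notation Y := (square R).

Definition itv_val (s : unit_itv R) : R := set_val s.

Lemma itv_val_continuous : continuous itv_val.
Proof. exact: initial_continuous. Qed.

Lemma to_unit_itvK x : 0 <= x <= 1 -> itv_val (to_unit_itv x) = x.
Proof. exact: clampr_id. Qed.

Lemma itv_valK s : to_unit_itv (itv_val s) = s.
Proof.
apply: val_inj => /=; apply: clampr_id; rewrite /itv_val.
by have := set_valP s; rewrite /= in_itv.
Qed.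

Lemma to_unit_itv_continuous : continuous (@to_unit_itv R).
Proof. by apply: continuous_comp_initial; exact: clampr_continuous. Qed.

Lemma compact_unit_itv : compact [set: unit_itv R].
Proof.
have -> : [set: unit_itv R] = @to_unit_itv R @` `[0, 1]%classic.
  apply/seteqP; split=> // s _; exists (itv_val s); last exact: itv_valK.
  exact: set_valP.
apply: continuous_compact; last exact: segment_compact.
exact/continuous_subspaceT/to_unit_itv_continuous.
Qed.

Lemma compact_square : compact [set: Y].
Proof. by rewrite -setXTT; apply: compact_setX; exact: compact_unit_itv. Qed.

Definition to_square (p : R * R) : Y := (to_unit_itv p.1, to_unit_itv p.2).

Lemma to_square_continuous : continuous to_square.
Proof.
move=> p; apply: (@cvg_pair _ _ _ (nbhs p)
  (nbhs (to_unit_itv p.1)) (nbhs (to_unit_itv p.2))).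
  apply: (@continuous_comp _ _ _ fst (@to_unit_itv R)); first exact: cvg_fst.
  exact: to_unit_itv_continuous.
apply: (@continuous_comp _ _ _ snd (@to_unit_itv R)); first exact: cvg_snd.
exact: to_unit_itv_continuous.
Qed.

End Square.

Section Weighted.
Context (X : ptopologicalType) (hX : compact [set: X]) (R : realType) (m : nat).
Local Notation C := R[i].
Local Notation B := (mxfun hX R m).

Definition weighted (h : contfun X C) (M : 'M[C]_m.+1) : B :=
  \matrix_(i, j) (h * contfun_cst X (M i j)).

Lemma ev_weighted h M y : ev (weighted h M) y = contfun_val h y *: M.
Proof. by apply/matrixP => i j; rewrite !mxE. Qed.

Definition const_fun (M : 'M[C]_m.+1) : B := weighted 1 M.

Lemma ev_const_fun M y : ev (const_fun M) y = M.
Proof. by rewrite ev_weighted -[RHS]scale1r. Qed.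

(** Evaluation at a point, seen as an endomorphism of the algebra by means of
    constant functions: thus one target algebra serves both for the whole family
    of representations and for each of its members. *)
Definition freeze (y : X) (f : B) : B := const_fun (ev f y).

Lemma star_hom_freeze y : star_hom (freeze y).
Proof.
split=> [c f g||f]; [|split=> [|f g]|]; apply: evP => y';
  rewrite ?(ev_const_fun, evD, evZ, evM, ev1, ev_star)//.
Qed.

End Weighted.

Section JoinCoordinates.
Local Open Scope quotient_scope.
Context (R : realType) (m n : nat) (w : R[i]).
Local Notation C := R[i].
Local Notation q := m.+2.
Local Notation J := (join R 'Z_q n).

(** The square root makes the squared moduli of the coordinates sum up to 1. *)
Definition pre_coord (i : 'I_n.+1) (x : join_pre R 'Z_q n) : C :=
  (Num.sqrt (join_bary x 0 i))%:C%C * w ^+ join_grp x i.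

Lemma pre_coord_continuous i : continuous (pre_coord i : _ -> C^o).
Proof.
move=> x; apply: (@cvgM C).
  apply: cvgcRI; last exact: cvg_cst.
  apply: (@continuous_comp _ _ _ (fun x => join_bary x 0 i) Num.sqrt);
    last exact: sqrt_continuous.
  apply: (@continuous_comp _ _ _ (@join_bary R 'Z_q n) (fun M => M 0 i));
    last exact: coord_continuous.
  apply: (@continuous_comp _ _ _ fst set_val); first exact: cvg_fst.
  exact: initial_continuous.
apply: cvg_near_cst; case: x => t h.
exists (setT, [set h]); first by split; [exact: filterT|exact: discrete_set1].
by move=> [t' h'] /= [_ ->].
Qed.

Lemma pre_coord_rel i x y : join_rel x y -> pre_coord i x = pre_coord i y.
Proof.
move=> /andP[/eqP xy /forallP/(_ i)/implyP]; rewrite /pre_coord -xy.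
by have [->|_ /(_ isT)/eqP ->//] := eqVneq (join_bary x 0 i) 0; rewrite sqrtr0 !mul0r.
Qed.

Lemma pre_coord_repr i x : pre_coord i (repr (\pi_J x)) = pre_coord i x.
Proof.
apply: pre_coord_rel; have : \pi_J (repr (\pi_J x)) = \pi_J x by rewrite reprK.
by move/eqmodP.
Qed.

Fact coord_cts i : continuous ((fun x : J => pre_coord i (repr x)) : J -> C^o).
Proof.
apply/quotient_continuous.
rewrite (_ : _ \o _ = pre_coord i); first exact: pre_coord_continuous.
by apply/funext => x /=; rewrite pre_coord_repr.
Qed.

Definition coord i : contfun J C := contfun_of (@coord_cts i).

Lemma coord_sum : normc w = 1 -> \sum_i coord i * star (coord i) = 1.
Proof.
move=> w1; apply: contfunP => x; rewrite contfun_val_sum.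
have [t0 t1] : simplex (join_bary (repr x)) by exact: set_valP.
rewrite -[RHS]/(1%:C%C) -t1 rmorph_sum; apply: eq_bigr => i _.
rewrite -[LHS]/(pre_coord i (repr x) * (pre_coord i (repr x))^*) mulrC mul_conjc.
rewrite normcM normcX w1 expr1n mulr1/= expr0n addr0 sqrtr_sqr.
by rewrite ger0_norm ?sqrtr_ge0// sqr_sqrtr.
Qed.

Lemma coord_translate i : w ^+ q = 1 ->
  contfun_precomp (join_translate 1) (coord i) = w *: coord i.
Proof.
move=> wq; apply: contfunP => x.
rewrite -[LHS]/(pre_coord i (repr (join_translate 1 x))).
rewrite -[RHS]/(w * pre_coord i (repr x)) pre_coord_repr /pre_coord /join_grp/= ffunE.
by rewrite -[in LHS]/(join_grp _ _) [in LHS]expr_ordS// mulrCA.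
Qed.

End JoinCoordinates.

(** * The family of representations *)

Section MainModel.
Context (R : realType) (m : nat) (theta : R).
Local Notation C := R[i].
Local Notation q := m.+2.
Local Notation Y := (square R).
Local Notation B := (mxfun (@compact_square R) R m.+1).
Local Notation zeta := (expi2pi theta).

(** Coefficients of the generators in the representation with parameters
    [(s, x)]: the moduli move along a quarter of circle with [s], while the first
    generator turns through the angle of [theta] as [x] goes from 0 to 1. *)
Definition ampl1 (y : Y) : C :=
  (sin (pi / 2 * itv_val y.1))%:C%C * cis (2 * pi * theta * itv_val y.2).
Definition ampl2 (y : Y) : C := (cos (pi / 2 * itv_val y.1))%:C%C.

Lemma itv_fst_continuous : continuous (fun y : Y => itv_val y.1).
Proof.
move=> y; apply: (@continuous_comp _ _ _ fst (@itv_val R)); first exact: cvg_fst.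
exact: itv_val_continuous.
Qed.

Lemma itv_snd_continuous : continuous (fun y : Y => itv_val y.2).
Proof.
move=> y; apply: (@continuous_comp _ _ _ snd (@itv_val R)); first exact: cvg_snd.
exact: itv_val_continuous.
Qed.

Lemma ampl1_continuous : continuous (ampl1 : Y -> C^o).
Proof.
move=> y; apply: (@cvgM C).
  apply: cvgcRI; last exact: cvg_cst.
  apply: (@continuous_comp _ _ _ (fun y : Y => pi / 2 * itv_val y.1) sin);
    last exact: continuous_sin.
  by apply: cvgM; [exact: cvg_cst|exact: itv_fst_continuous].
by apply: cvg_cis; apply: cvgM; [exact: cvg_cst|exact: itv_snd_continuous].
Qed.

Lemma ampl2_continuous : continuous (ampl2 : Y -> C^o).
Proof.
move=> y; apply: cvgcRI; last exact: cvg_cst.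
apply: (@continuous_comp _ _ _ (fun y : Y => pi / 2 * itv_val y.1) cos);
  last exact: continuous_cos.
by apply: cvgM; [exact: cvg_cst|exact: itv_fst_continuous].
Qed.

Context (zetaq : zeta ^+ q = 1).

Let zeta1 : normc zeta = 1. Proof. exact: normc_cis. Qed.
Let one1 : normc (1 : C) = 1. Proof. exact: normc1. Qed.

Let shift_unit (z : C) : normc z = 1 -> shift m z * adj (shift m z) = 1.
Proof. by move=> z1; apply/unitaryC/shift_unitary. Qed.

Context (model1 model2 : B)
  (ev_model1 : forall y, ev model1 y = ampl1 y *: shift m 1)
  (ev_model2 : forall y, ev model2 y = ampl2 y *: shift m zeta).

Lemma model_rel : sphere3_rel theta model1 model2.
Proof.
split; apply: evP => y;
  rewrite ?(evD, evZ, evM, ev_star, ev_model1, ev_model2, ev1) ?adjZ.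
- by rewrite -!scalerAl -!scalerAr !scalerA mulrC shift_unit// shift_unitary.
- by rewrite -!scalerAl -!scalerAr !scalerA mulrC shift_unit// shift_unitary.
- rewrite -!scalerAl -!scalerAr !scalerA shift_comm// !scalerA.
  by congr (_ *: _); ring.
rewrite -!scalerAl -!scalerAr !scalerA !shift_unit// -scalerDl -[RHS]scale1r.
congr (_ *: _); rewrite ![_ * _^*]mulrC !mul_conjc -rmorphD
  /ampl1 normcM normc_cis mulr1 /ampl2.
by rewrite /normc/= !expr0n !addr0 !sqrtr_sqr !real_normK
  ?num_real// addrC cos2Dsin2.
Qed.

Context (n : nat) (A : cstarAlgType R) (z1 z2 : A)
  (hA : is_sphere3 theta z1 z2).
Local Notation w := (expi2pi (q%:R^-1 : R)).
Context (act : A -> A) (hact : star_hom act)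
  (hz1 : act z1 = w *: z1) (hz2 : act z2 = w *: z2).
Context (a : 'I_n -> A)
  (aC : forall i j, a i * a j = a j * a i)
  (a1 : \sum_i a i * star (a i) = 1)
  (aw : forall i, act (a i) = w *: a i).

Let wp : q.-primitive_root w. Proof. exact: expi2pi_prim. Qed.
Let w1 : normc w = 1. Proof. exact: normc_cis. Qed.
Let wq : w ^+ q = 1. Proof. exact: prim_expr_order wp. Qed.

(** The representations at the parameters [(s, 0)] and [(s, 1)] are conjugate
    by [shift m zeta], since this conjugation multiplies [shift m 1] by [zeta].
    At [s = 0] and [s = 1] the representation has a commutative image, which
    commutes with one of the two shifts. The ratios of the images of the [a i]
    therefore have all the properties excluded by [no_homotopy]. *)
Lemma no_commuting_family : zeta = 1.
Proof.
have [[pi0 [pi0s e1 e2]] _] := hA.2 B model1 model2 model_rel.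
have pih := star_hom_lrmorphism pi0s.
pose b y i := ev (pi0 (a i)) y.
(* constants are known only through their values, so that no rewriting step can
   unfold a matrix of functions *)
have [W EW] : exists W : B, forall y, ev W y = clock m w.
  by exists (const_fun _ (clock m w)) => y; exact: ev_const_fun.
have /choice[V EV] (z : C) : exists V : B, forall y, ev V y = shift m z.
  by exists (const_fun _ (shift m z)) => y; exact: ev_const_fun.
have /choice[Fr /all_and2[hFr EFr]] (y : Y) : exists Fr : B -> B,
    star_hom Fr /\ forall f y', ev (Fr f) y' = ev f y.
  by exists (freeze y); split; [exact: star_hom_freeze|move=> f y'; exact: ev_const_fun].
have WW : star W * W = 1.
  by apply: evP => y; rewrite evM ev_star EW ev1 clock_unitary.
have WW' : W * star W = 1.
  by apply: evP => y; rewrite evM ev_star EW ev1; apply/unitaryC/clock_unitary.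
have VV (z : C) : normc z = 1 -> star (V z) * V z = 1.
  by move=> zn; apply: evP => y; rewrite evM ev_star EV ev1 shift_unitary.
have VV' (z : C) : normc z = 1 -> V z * star (V z) = 1.
  by move=> zn; apply: evP => y; rewrite evM ev_star EV ev1 shift_unit.
(* by uniqueness: both sides multiply the generators by [w] *)
have actE : pi0 \o act =1 (fun x => W * x * star W) \o pi0.
  have Wgen (f : B) (c : Y -> C) (z : C) : (forall y, ev f y = c y *: shift m z) ->
      W * f * star W = w *: f.
    move=> Ef; apply: evP => y; rewrite !(evM, evZ, ev_star, Ef, EW).
    rewrite -scalerAr -scalerAl clock_shift// -!scalerAl -mulrA.
    by rewrite (unitaryC (clock_unitary m w1)) mulr1 !scalerA mulrC.
  apply: (sphere3_ext hA); first exact: star_hom_comp.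
  - by apply: star_hom_comp => //; exact: star_hom_inner.
  - by rewrite /= hz1 star_homZ// e1 (Wgen _ _ _ ev_model1).
  - by rewrite /= hz2 star_homZ// e2 (Wgen _ _ _ ev_model2).
have fam y : clock_family w (b y).
  split=> [i j||i].
  - by rewrite /b -!evM -!rmorphM/= aC.
  - transitivity (ev (pi0 (\sum_i a i * star (a i))) y); last first.
      by rewrite a1 rmorph1 ev1.
    rewrite rmorph_sum ev_sum.
    by apply: eq_bigr => i _; rewrite rmorphM/= pi0s evM ev_star.
  have := actE (a i); rewrite /= aw star_homZ// => /(congr1 (fun f => f * W)).
  rewrite -[_ * star W * W]mulrA WW mulr1 -scalerAl => /(congr1 (fun f => ev f y)).
  by rewrite !(evM, evZ, EW) => <-.
(* by uniqueness again, two points being compared through constant functions *)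
have transport (z : C) y y' : normc z = 1 ->
    ampl1 y' *: shift m 1 * shift m z = ampl1 y *: (shift m z * shift m 1) ->
    ampl2 y' *: shift m zeta * shift m z = ampl2 y *: (shift m z * shift m zeta) ->
    forall i, b y' i * shift m z = shift m z * b y i.
  move=> zn h1 h2 i.
  have : Fr y' \o pi0 =1 (fun x => V z * x * star (V z)) \o (Fr y \o pi0).
    apply: (sphere3_ext hA).
    - by apply: star_hom_comp => //; exact: hFr.
    - apply: star_hom_comp; first by apply: star_hom_inner; [exact: VV|exact: VV'].
      by apply: star_hom_comp => //; exact: hFr.
    - apply: evP => y0; rewrite /= e1 !(evM, ev_star, EV, EFr) !ev_model1.
      by rewrite -scalerAr -h1 -mulrA shift_unit// mulr1.
    apply: evP => y0; rewrite /= e2 !(evM, ev_star, EV, EFr) !ev_model2.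
    by rewrite -scalerAr -h2 -mulrA shift_unit// mulr1.
  move=> /(_ (a i))/= /(congr1 (fun f => ev f y * shift m z)).
  by rewrite !(evM, ev_star, EV, EFr) -[_ * adj _ * _]mulrA shift_unitary// mulr1.
pose rho k (p : R * R) := ratio (b (to_square p)) k.
have i0 : itv_val (to_unit_itv (0 : R)) = 0 by rewrite to_unit_itvK ?lexx ?ler01.
have i1 : itv_val (to_unit_itv (1 : R)) = 1 by rewrite to_unit_itvK ?lexx ?ler01.
apply: (@no_homotopy R m rho).
- move=> k p.
  (* a ratio is a polynomial in matrix entries, which are continuous functions *)
  pose r : contfun Y C := \sum_i
    contfun_star (pi0 (a i) (k + 1) k) * pi0 (a i) (k + 1 + 1) (k + 1).
  have -> : rho k = contfun_val r \o @to_square R.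
    apply/funext => p'; rewrite /= contfun_val_sum; apply: eq_bigr => i _.
    by rewrite !mxE.
  apply: (@continuous_comp _ _ C^o (@to_square R) (contfun_val r)).
    exact: to_square_continuous.
  exact: contfun_cts.
- by move=> k p; exact: (ratio_norm wp _ (fam _)).
- by move=> p; exact: (ratio_prod wp (fam _)).
- move=> k t; apply: (ratio_conj k zeta1 zetaq).
  apply: transport => //.
    rewrite shift_comm// -scalerAl scalerA; congr (_ *: _).
    by rewrite /ampl1/= i0 i1 mulr0 mulr1 cis0 mulr1.
  by rewrite /ampl2/= -scalerAl.
- move=> k x; apply: (ratio_comm wp) => //; apply: transport => //.
    by rewrite /ampl1/= i0 mulr0 sin0 !mul0r !scale0r mul0r.
  by rewrite /ampl2/= -scalerAl.
- move=> k x; apply: (ratio_comm wp) => //; first by rewrite expr1n.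
  apply: transport => //.
    by rewrite -scalerAl.
  by rewrite /ampl2/= i1 mulr1 cos_pihalf !scale0r mul0r.
Qed.

End MainModel.

(** * The theorem *)

Lemma exprz_absz_eq1 (F : fieldType) (x : F) (p : int) :
  x ^ p = 1 -> x ^+ `|p|%N = 1.
Proof.
case: p => k //; rewrite NegzE -exprnN abszN => /(congr1 (@GRing.inv _)).
by rewrite invrK invr1.
Qed.

Lemma expi2pi_rat (R : realType) (p : int) (q : nat) : (0 < q)%N ->
  expi2pi (p%:~R / q%:R : R) = (expi2pi (q%:R^-1 : R)) ^ p.
Proof.
move=> q0; have h (k : nat) : expi2pi (k%:R / q%:R : R) = expi2pi (q%:R^-1 : R) ^+ k.
  by rewrite !expi2piE -cisMn; congr cis; rewrite -[RHS]mulr_natr; ring.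
case: p => k; first by rewrite -exprnP -h.
rewrite NegzE -exprnN -h mulrNz.
have cis_neq0 (x : R) : cis x != 0.
  apply/eqP => x0; have := normc_cis x.
  by rewrite x0 (normc0 R) => /eqP; rewrite eq_sym oner_eq0.
apply: (mulIf (cis_neq0 (2 * pi * (k.+1%:R / q%:R)))).
rewrite mulVf ?expi2piE ?cis_neq0// -cisD -mulrDr -mulrDl addNr.
by rewrite mul0r mulr0 cis0.
Qed.

Unset Implicit Arguments.

Theorem proposition4p7 (R : realType) (p : int) (q : nat)
    (hq : (1 < q)%N) (hpq : coprime `|p|%N q)
    (A : cstarAlgType R) (z1 z2 : A)
    (hA : is_sphere3 (p%:~R / q%:R : R) z1 z2)
    (act : 'Z_q -> {lrmorphism A -> A}) (hact : star_action act)
    (hz1 : act 1 z1 = expi2pi (q%:R^-1 : R) *: z1)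
    (hz2 : act 1 z2 = expi2pi (q%:R^-1 : R) *: z2) :
  SLT_dim act = +oo%E.
Proof.
case: q hq hpq hA act hact hz1 hz2 => [|[|m]]// _ hpq hA act hact hz1 hz2.
set w := expi2pi _ in hz1 hz2; have wp : m.+2.-primitive_root w by exact: expi2pi_prim.
have wq := prim_expr_order wp.
have zetaq : expi2pi (p%:~R / m.+2%:R : R) ^+ m.+2 = 1.
  by rewrite expi2pi_rat// exprnP exprzAC -exprnP wq exp1rz.
pose theta : R := p%:~R / m.+2%:R.
suff none n : ~ SLT_le act n.
  rewrite /SLT_dim (_ : [set _ | _ in _] = set0) ?ereal_inf0//.
  by apply/seteqP; split=> // x [n hn _]; case: (none n hn).
move=> [phi [phis phi_act]].
(* an equivariant map from the join provides the images of its coordinates *)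
pose c i := coord m w (n := n) i.
have [model1 E1] : exists f : mxfun (@compact_square R) R m.+1,
    forall y, ev f y = ampl1 theta y *: shift m 1.
  exists (weighted _ (contfun_of (@ampl1_continuous R theta)) (shift m 1)) => y.
  by rewrite ev_weighted.
have [model2 E2] : exists f : mxfun (@compact_square R) R m.+1,
    forall y, ev f y = ampl2 y *: shift m (expi2pi theta).
  exists (weighted _ (contfun_of (@ampl2_continuous R)) (shift m (expi2pi theta))) => y.
  by rewrite ev_weighted.
have : expi2pi theta = 1.
  have act_hom : star_hom (act 1) by apply: star_hom_lrmorphism; have [h _ _] := hact.
  apply: (no_commuting_family zetaq E1 E2 hA act_hom hz1 hz2 (a := fun i => phi (c i))).
  - by move=> i j; rewrite -!rmorphM/= mulrC.
  - rewrite -[RHS](rmorph1 phi) -(@coord_sum R m n w (normc_cis _)) rmorph_sum.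
    by apply: eq_bigr => i _; rewrite rmorphM/= phis.
  by move=> i; rewrite -phi_act coord_translate// linearZ.
(* but [w ^ p] is different from 1 because [p] is prime to [q > 1] *)
rewrite /theta expi2pi_rat// -/w => wp1.
have /eqP := exprz_absz_eq1 wp1.
rewrite -(prim_order_dvd wp) => dvd.
by move: hpq; rewrite coprime_sym /coprime (gcdn_idPl dvd).
Qed.
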